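(* Let $n\in\mathbb{N}$, $\alpha \in (0,n)$, $1<s<n/\alpha$, $p \in [1,+\infty)$, and suppose $f \in L^p(\mathrm{cap}_{\alpha,s})$. Then for $\mathrm{cap}_{\alpha,s}$-almost every $x\in\mathbb{R}^n$ the function $$f^*(x):= \lim_{r \to 0} \frac{1}{|B(x,r)|}\int_{B(x,r)}f(y)\,dy$$ is well-defined and one has the convergence $$\lim_{r \to 0} \frac{1}{\mathrm{cap}_{\alpha,s}(B(0,1))r^{n-\alpha s}}\int_{B(x,r)}|f-f^*(x)|^p \,d\mathrm{cap}_{\alpha,s} = 0 .$$
   Context: For $\alpha\in(0,n)$ and $1<s<\infty$ the Riesz capacity of $E\subseteq\mathbb{R}^n$ is $\mathrm{cap}_{\alpha,s}(E)=\inf\{\|\varphi\|_{L^{s}(\mathbb{R}^{n})}^{s}:\varphi\geq 0,\ I_{\alpha}\ast\varphi\geq 1\text{ on }E\}$, where $I_{\alpha}(x)=\frac{1}{\gamma(\alpha)}\frac{1}{|x|^{n-\alpha}}$ is the Riesz kernel, with the usual normalization $\gamma(\alpha)=\pi^{n/2}2^{\alpha}\Gamma(\alpha/2)/\Gamma((n-\alpha)/2)$. ''$\mathrm{cap}_{\alpha,s}$-almost every'' means outside a set of zero $\mathrm{cap}_{\alpha,s}$-capacity. For a $\mathrm{cap}_{\alpha,s}$-almost everywhere defined function $g$ with values in $[0,\infty]$, the Choquet integral is $\int_{\mathbb{R}^n} g \, d\mathrm{cap}_{\alpha,s} := \int_0^\infty \mathrm{cap}_{\alpha,s}(\{ g>t\})\,dt$,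 and $\int_A g\,d\mathrm{cap}_{\alpha,s}:=\int_{\mathbb{R}^n} g\chi_A\,d\mathrm{cap}_{\alpha,s}$ for $A\subseteq\mathbb{R}^n$. A function $f$ (real-valued, defined $\mathrm{cap}_{\alpha,s}$-almost everywhere) is $\mathrm{cap}_{\alpha,s}$-quasicontinuous if for every $\varepsilon>0$ there is an open set $O$ with $\mathrm{cap}_{\alpha,s}(O)<\varepsilon$ such that $f$ restricted to $\mathbb{R}^n\setminus O$ is continuous. For $0<p<\infty$, $L^p(\mathrm{cap}_{\alpha,s})$ is the set of $\mathrm{cap}_{\alpha,s}$-quasicontinuous functions $f$ with $(\int_{\mathbb{R}^n} |f|^p \, d \mathrm{cap}_{\alpha,s})^{1/p}<\infty$. $B(x,r)$ is the open ball with center $x$ and radius $r$, $|B|$ denotes Lebesgue measure, and $dy$ integration with respect to it. *)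

(* Defs.v *)
From HB Require Import structures.
From mathcomp Require Import all_boot all_order all_algebra.
From mathcomp Require Import all_classical all_reals all_analysis.

Set Implicit Arguments.
Unset Strict Implicit.
Unset Printing Implicit Defensive.

Import Order.TTheory GRing.Theory Num.Theory.
Import numFieldNormedType.Exports.

Local Open Scope classical_set_scope.
Local Open Scope ring_scope.

(* R^n is 'rV[R]_n with the library's topology.  The library norm `|x| on
   'rV[R]_n is the sup norm, hence the Euclidean norm and balls below. *)

Section euclidean.
Context {R : realType} {n : nat}.
Implicit Types x y : 'rV[R]_n.

Definition eucl_norm x : R := Num.sqrt (\sum_(i < n) x ord0 i ^+ 2).

Definition eucl_ball x (r : R) : set 'rV[R]_n :=
  [set y | eucl_norm (y - x) < r].

End euclidean.

Section lebesgue_measure_rV.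
Context (R : realType).

Definition cylinders (n : nat) : set (set 'rV[R]_n) :=
  [set A | exists (i : 'I_n) (B : set (measurableTypeR R)),
     measurable B /\ A = [set x : 'rV[R]_n | B (x ord0 i)]].

(* The sigma-algebra generated by the coordinates is the Borel one. *)
Definition borel_rV (n : nat) := g_sigma_algebraType (@cylinders n).

Lemma measurable_to_borel_rV d (T : measurableType d) n (h : T -> borel_rV n) :
  (forall i, measurable_fun setT
     (fun t => (h t : 'rV[R]_n) ord0 i : measurableTypeR R)) ->
  measurable_fun setT h.
Proof.
move=> mh; apply: (@measurability _ _ T (borel_rV n) setT h (@cylinders n)) => //.
move=> _ [_ [i [B [mB ->]]] <-].
exact: (mh i measurableT B mB).
Qed.

Lemma measurable_rV_coord n (i : 'I_n) :
  measurable_fun setT (fun x : borel_rV n => (x : 'rV[R]_n) ord0 i : measurableTypeR R).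
Proof.
move=> _ B mB; rewrite setTI.
by apply: sub_gen_smallest; exists i, B.
Qed.

Definition rV_cons (n : nat) (vx : borel_rV n * measurableTypeR R) :
  borel_rV n.+1 := row_mx (vx.2%:M : 'rV[R]_1) (vx.1 : 'rV[R]_n).

Lemma measurable_rV_cons n : measurable_fun setT (@rV_cons n).
Proof.
apply: measurable_to_borel_rV => i.
case: (split_ordP (i : 'I_(1 + n))) => j ->.
- rewrite (_ : (fun t => _) = snd); first exact: measurable_snd.
  by apply/funext => t; rewrite /rV_cons [LHS]row_mxEl (ord1 j) mxE.
- rewrite (_ : (fun t => _) =
    (fun x : borel_rV n => (x : 'rV[R]_n) ord0 j : measurableTypeR R) \o fst).
    exact: (measurableT_comp (@measurable_rV_coord n j)).
  by apply/funext => t; rewrite /rV_cons [LHS]row_mxEr.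
Qed.

(* The product of m and the one-dimensional Lebesgue measure, transported
   along (v, x) |-> (x, v). *)
Definition rV_cons_product (n : nat)
    (m : {measure set (borel_rV n) -> \bar R}) : set (borel_rV n.+1) -> \bar R :=
  pushforward (m \x (@lebesgue_measure R))%E (@rV_cons n).

HB.instance Definition _ n m := Measure.copy (@rV_cons_product n m)
  (measure_function_pushforward__canonical__measure_function_Measure
     (m \x (@lebesgue_measure R))%E (@measurable_rV_cons n)).

Fixpoint borel_lebesgue (n : nat) : {measure set (borel_rV n) -> \bar R} :=
  match n with
  | 0%N => dirac ((0 : 'rV[R]_0) : borel_rV 0)
  | n'.+1 => rV_cons_product (borel_lebesgue n')
  end.

(* R^n with the sigma-algebra of Lebesgue (Caratheodory) measurable sets; a
   quasicontinuous function need not be Borel measurable. *)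
Definition leb_rV (n : nat) := caratheodory_type (borel_lebesgue n)^*%mu.

Definition lebesgue_rV (n : nat) : {measure set (leb_rV n) -> \bar R} :=
  @completed_measure_extension _ _ _ (borel_lebesgue n).

End lebesgue_measure_rV.

Arguments lebesgue_rV {R} n.

Definition Gamma {R : realType} (z : R) : R :=
  \int[lebesgue_measure]_(t in `]0, +oo[) (t `^ (z - 1) * expR (- t)).

Section riesz_capacity.
Context {R : realType} {n : nat}.
Variables alpha s : R.
Implicit Types (x : 'rV[R]_n) (A D E : set 'rV[R]_n).

Definition riesz_const : R :=
  pi `^ (n%:R / 2) * 2 `^ alpha * Gamma (alpha / 2) /
  Gamma ((n%:R - alpha) / 2).

(* Equal to +oo at the origin, since the inverse of 0 in \bar R is +oo. *)
Definition riesz_kernel x : \bar R :=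
  ((riesz_const^-1)%:E * ((eucl_norm x `^ (n%:R - alpha))%:E)^-1)%E.

Definition riesz_potential (phi : 'rV[R]_n -> R) x : \bar R :=
  (\int[lebesgue_rV n]_y (riesz_kernel (x - y)%R * (phi y)%:E))%E.

Definition riesz_cap E : \bar R :=
  ereal_inf [set ('N[lebesgue_rV n]_(s%:E)[EFin \o phi] `^ s)%E
    | phi in [set phi : leb_rV R n -> R |
        [/\ measurable_fun setT phi,
            (forall x, 0 <= phi x) &
            (forall x, E x -> (1 <= riesz_potential phi x)%E)]]].

Definition cap_ae (P : 'rV[R]_n -> Prop) : Prop :=
  exists2 N, riesz_cap N = 0%E & forall x, ~ N x -> P x.

(* The Choquet integral of g over A.  For t >= 0 the set below is
   { g \chi_A > t }; only the values of g on A matter. *)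
Definition choquet A (g : 'rV[R]_n -> \bar R) : \bar R :=
  (\int[lebesgue_measure]_(t in `[0%R, +oo[)
     riesz_cap [set x | A x /\ t%:E < g x])%E.

(* A real-valued function defined capacity-almost everywhere is given by its
   domain D, whose complement has zero capacity, and a map f whose values
   outside D are never used: all integrals of f are taken over subsets of D. *)
Definition quasicontinuous D (f : 'rV[R]_n -> R) : Prop :=
  cap_ae D /\
  forall eps : R, 0 < eps -> exists O : set 'rV[R]_n,
    [/\ open O, (riesz_cap O < eps%:E)%E & {within D `\` O, continuous f}].

Definition Lp_cap (p : R) D (f : 'rV[R]_n -> R) : Prop :=
  quasicontinuous D f /\
  ((choquet D (fun x => (`|f x| `^ p)%:E) `^ p^-1)%E < +oo)%E.

End riesz_capacity.

Section averages.
Context {R : realType} {n : nat}.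
Variables (D : set 'rV[R]_n) (f : 'rV[R]_n -> R).

Definition ball_average (x : 'rV[R]_n) (r : R) : R :=
  (fine (lebesgue_rV n (eucl_ball x r)))^-1 *
  \int[lebesgue_rV n]_(y in eucl_ball x r `&` D) f y.

Definition average_limit (x : 'rV[R]_n) : R :=
  lim (ball_average x r @[r --> 0^'+]).

End averages.

(* Main.v *)
(* Let [d = n - alpha * s] and let [phi] be admissible for a set [E].  In a ball
   [B(x, r)] the part of the potential of [phi] coming from outside [B(x, 2 r)]
   is comparable with its value at [x]; hence, unless the potential at [x] is at
   least a fixed constant, [cap (E /\ B(x, r))] is at most a multiple of the
   integral of [phi ^ s] over [B(x, 2 r)].  Unlike capacities, such integrals can be
   summed: for countably many sets [E_k] with small total capacity and admissible
   [phi_k], put [Phi = \sum_k phi_k ^ s].  The weak-type bound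
   [cap {x | sup_r r^-d \int_B(x,r) Phi > l} <= C |Phi|_1 / l] (a covering
   argument by maximal dyadic cells and [cap B(x, r) <= C r^d]) yields
   [\sum_k cap (E_k /\ B(x, r)) <= l r^d] off a set of small capacity.
   With the [E_k] an exceptional open set of the quasicontinuity and the tail of
   the superlevel sets of [|f|^p], this gives
   [\int_B(x,r) |f - f x|^p dcap = o(r^d)] for quasi every [x], by Borel-Cantelli.
   Lebesgue measure is controlled by capacity, [|E| <= C r^(alpha s) cap E] for [E]
   in [B(x, r)], so that [f x] is also the limit of the averages of [f]. *)

Require Import Defs.
From HB Require Import structures.
From mathcomp Require Import all_boot all_order all_algebra.
From mathcomp Require Import all_classical all_reals all_analysis.
From mathcomp Require Import measurable_realfun zify ring lra.

Set Implicit Arguments.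
Unset Strict Implicit.
Unset Printing Implicit Defensive.

Import Order.TTheory GRing.Theory Num.Theory.
Import numFieldNormedType.Exports.

Local Open Scope classical_set_scope.
Local Open Scope ring_scope.

(** * Lebesgue measure on cubes *)

Section cubes.
Context {R : realType} {n : nat}.
Implicit Types x y : 'rV[R]_n.

(** Capacity is only subadditive, so no bound on the capacity of a union controls
    [\sum_k cap (E_k /\ B(x, r))], and a Choquet integral cut into levels is exactly such a sum.
    Hence the maximal estimate is applied to [Phi], a density that records every level, and not to
    [f]. Families with total capacity below [4^-j] are treated at density [2^-j]: the exceptional
    sets then have capacity of order [2^-j], summable for Borel-Cantelli, while the densities tend
    to 0. Passages between a function and its powers rest on [u <= a + a^(1-q) u^q], with [a]
    adapted to the scale, in the role of Hölder's inequality; the bound is linear in [u^q], so it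
    can be integrated directly. The condition [alpha * s < n] acts in two ways: it makes [d]
    positive, so that heavy cells compare with cubes of nearby size, and it makes the far part of a
    potential integrable when Lebesgue measure is compared with capacity. Sup-norm cubes stand in
    for Euclidean balls, because their measure is explicit and they fit dyadic cells. *)

Definition cube x (r : R) : set 'rV[R]_n :=
  [set y | forall i, `|y ord0 i - x ord0 i| < r].

Lemma sub_cube x r1 r2 : r1 <= r2 -> cube x r1 `<=` cube x r2.
Proof. by move=> r12 y /= yx i; exact: lt_le_trans (yx i) r12. Qed.

Lemma measurable_cube x r : measurable (cube x r : set (borel_rV R n)).
Proof.
have -> : cube x r = \bigcap_(i in [set: 'I_n])
    [set y : 'rV[R]_n | ball (x ord0 i) r (y ord0 i)].
  apply/seteqP; split=> [y xy i _ /=|y xy i].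
    by rewrite /ball/= distrC; exact: xy.
  by have := xy i I; rewrite /= /ball/= distrC.
apply: fin_bigcap_measurable => // i _.
apply: sub_gen_smallest; exists i, (ball (x ord0 i) r); split => //.
exact: measurable_ball.
Qed.

End cubes.

Section lebesgue_rV_basics.
Context {R : realType}.

Lemma rV_cons_lshift n (vx : borel_rV R n * measurableTypeR R) (j : 'I_1) :
  (rV_cons vx : 'rV[R]_n.+1) ord0 (lshift n j : 'I_(1 + n)) = vx.2.
Proof. by rewrite [LHS]row_mxEl (ord1 j) mxE. Qed.

Lemma rV_cons_rshift n (vx : borel_rV R n * measurableTypeR R) (j : 'I_n) :
  (rV_cons vx : 'rV[R]_n.+1) ord0 (rshift 1 j : 'I_(1 + n)) =
  (vx.1 : 'rV[R]_n) ord0 j.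
Proof. by rewrite [LHS]row_mxEr. Qed.

(** Induction along the recursive construction of the measure: under [rV_cons] a cube pulls back to
    a cube of one dimension less times an interval. *)
Lemma borel_lebesgue_cube n (x : 'rV[R]_n) r : 0 <= r ->
  borel_lebesgue R n (cube x r) = ((r *+ 2) ^+ n)%:E.
Proof.
move=> r0; elim: n x => [|n IH] x.
  rewrite /= diracE expr0 mem_set//=.
  by case.
rewrite [LHS]/= /rV_cons_product /pushforward.
pose x' : 'rV[R]_(1 + n) := x.
have -> : @rV_cons R n @^-1` cube x r = cube (rsubmx x') r `*` ball (x ord0 ord0) r.
  have e0 : lshift n ord0 = ord0 :> 'I_(1 + n) by exact/val_inj.
  apply/seteqP; split=> [[v t]/= h|[v t] /= [hv ht] i].
    split=> [i|].
      by have := h (rshift 1 i : 'I_(1 + n)); rewrite rV_cons_rshift/= !mxE.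
    by have := h ord0; rewrite /ball/= distrC -[in rV_cons _ _ _]e0 rV_cons_lshift.
  case: (split_ordP (i : 'I_(1 + n))) => j ->.
    rewrite rV_cons_lshift (ord1 j) /= e0.
    by move: ht; rewrite /ball/= distrC.
  by rewrite rV_cons_rshift; have := hv j; rewrite !mxE.
rewrite product_measure1E//=; [|exact: measurable_cube|exact: measurable_ball].
by rewrite IH lebesgue_measure_ball// -EFinM exprSr.
Qed.

Lemma borel_lebesgue_sigma_finite n :
  sigma_finite [set: borel_rV R n] (borel_lebesgue R n).
Proof.
exists (fun k => cube (0 : 'rV[R]_n) k%:R).
  apply/seteqP; split=> // x _ /=.
  exists (Num.truncn (\sum_i `|x ord0 i|)).+1 => // i; rewrite mxE subr0.
  apply: le_lt_trans (truncnS_gt _).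
  by rewrite (bigD1 i)//= lerDl sumr_ge0.
move=> k; split; first exact: measurable_cube.
by rewrite /= borel_lebesgue_cube// ltry.
Qed.

Lemma lebesgue_rV_sigma_finite n :
  sigma_finite [set: leb_rV R n] (lebesgue_rV n).
Proof.
exact/completed_measure_extension_sigma_finite/borel_lebesgue_sigma_finite.
Qed.

(** The same measure as [lebesgue_rV], bundled with its sigma-finiteness in the form that the
    Fubini-Tonelli theorems take. *)
Definition sf_lebesgue n : {sigma_finite_measure set (leb_rV R n) -> \bar R} :=
  HB.pack_for {sigma_finite_measure set (leb_rV R n) -> \bar R}
    (@completed_measure_extension _ _ _ (borel_lebesgue R n))
    (@Measure_isSigmaFinite.Build _ _ _
       (@completed_measure_extension _ _ _ (borel_lebesgue R n))
       (@lebesgue_rV_sigma_finite n)).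


Lemma lebesgue_rV_complete n : measure_is_complete (@lebesgue_rV R n).
Proof. exact: measure_is_complete_caratheodory. Qed.

Lemma measurable_borel_leb n (A : set 'rV[R]_n) :
  measurable (A : set (borel_rV R n)) -> measurable (A : set (leb_rV R n)).
Proof. by move=> mA; exact: caratheodory_measurable_mu_ext. Qed.

Lemma lebesgue_rV_borel n (A : set 'rV[R]_n) :
  measurable (A : set (borel_rV R n)) ->
  lebesgue_rV n A = borel_lebesgue R n A.
Proof. by move=> mA; exact: measurable_mu_extE. Qed.

Lemma lebesgue_rV_cube n (x : 'rV[R]_n) r : 0 <= r ->
  lebesgue_rV n (cube x r) = ((r *+ 2) ^+ n)%:E.
Proof.
move=> r0; rewrite lebesgue_rV_borel ?borel_lebesgue_cube//.
exact: measurable_cube.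
Qed.


Lemma measurable_cube_leb n (x : 'rV[R]_n) r :
  measurable (cube x r : set (leb_rV R n)).
Proof. by apply: measurable_borel_leb; exact: measurable_cube. Qed.

Lemma integralZl_rV n (k : R) (f : leb_rV R n -> \bar R) :
  measurable_fun setT f -> (forall y, 0 <= f y)%E -> 0 <= k ->
  (\int[lebesgue_rV n]_y (k%:E * f y) = k%:E * \int[lebesgue_rV n]_y f y)%E.
Proof. by move=> mf f0; apply: ge0_integralZl_EFin. Qed.

Lemma integralD_rV n (f g : leb_rV R n -> \bar R) :
  measurable_fun setT f -> (forall y, 0 <= f y)%E ->
  measurable_fun setT g -> (forall y, 0 <= g y)%E ->
  (\int[lebesgue_rV n]_y (f y + g y) =
   \int[lebesgue_rV n]_y f y + \int[lebesgue_rV n]_y g y)%E.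
Proof. by move=> mf f0 mg g0; apply: ge0_integralD. Qed.

Lemma integral_series_rV n (f : nat -> leb_rV R n -> \bar R) :
  (forall k, measurable_fun setT (f k)) -> (forall k y, 0 <= f k y)%E ->
  (\int[lebesgue_rV n]_y (\sum_(k <oo) f k y) =
   \sum_(k <oo) \int[lebesgue_rV n]_y f k y)%E.
Proof. by move=> mf f0; apply: integral_nneseries. Qed.

End lebesgue_rV_basics.

(** * Euclidean norm, balls and open sets *)

Section borel_sets.
Context {R : realType} {n : nat}.
Implicit Types x y : 'rV[R]_n.

Lemma eucl_norm_ge0 x : 0 <= eucl_norm x.
Proof. exact: sqrtr_ge0. Qed.

Lemma coord_le_eucl_norm x i : `|x ord0 i| <= eucl_norm x.
Proof.
rewrite -sqrtr_sqr ler_wsqrtr// (bigD1 i)//= lerDl.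
by apply: sumr_ge0 => j _; exact: sqr_ge0.
Qed.

Lemma eucl_norm_le_sum x : eucl_norm x <= \sum_i `|x ord0 i|.
Proof.
have s0 : 0 <= \sum_i `|x ord0 i| by apply: sumr_ge0.
rewrite -[leRHS]ger0_norm// -sqrtr_sqr ler_wsqrtr// expr2 mulr_suml ler_sum// => i _.
rewrite -real_normK ?num_real// expr2 ler_wpM2l//.
by rewrite (bigD1 i)//= lerDl sumr_ge0.
Qed.

Lemma eucl_norm_le x M : (forall i, `|x ord0 i| <= M) ->
  eucl_norm x <= n%:R * M.
Proof.
move=> xM; apply: le_trans (eucl_norm_le_sum x) _.
rewrite mulr_natl -[in leRHS](card_ord n) -sumr_const.
by apply: ler_sum => i _; exact: xM.
Qed.

Lemma eucl_norm_eq0 x : eucl_norm x = 0 -> x = 0.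
Proof.
move=> x0; apply/rowP => i; rewrite mxE; apply/eqP.
by rewrite -normr_le0 -x0 coord_le_eucl_norm.
Qed.

Lemma eucl_norm0 : eucl_norm (0 : 'rV[R]_n) = 0.
Proof.
apply/eqP; rewrite eq_le eucl_norm_ge0 andbT.
by have := @eucl_norm_le 0 0; rewrite mulr0; apply=> i; rewrite mxE normr0.
Qed.

Lemma eucl_norm_sub_eq0 x y : (eucl_norm (x - y) == 0) = (x == y).
Proof.
apply/eqP/eqP => [/eucl_norm_eq0/eqP|->]; first by rewrite subr_eq0 => /eqP.
by rewrite subrr eucl_norm0.
Qed.

Lemma eucl_normC x y : eucl_norm (x - y) = eucl_norm (y - x).
Proof.
by congr Num.sqrt; apply: eq_bigr => i _; rewrite !mxE -sqrrN opprB.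
Qed.

Lemma sub_eucl_ball_cube x r : eucl_ball x r `<=` cube x r.
Proof.
move=> y yx i; apply: le_lt_trans yx.
by have := coord_le_eucl_norm (y - x) i; rewrite !mxE.
Qed.

(** The norm is at most [n] times the largest coordinate; dividing by [n.+1] makes the inequality
    strict and covers dimension 0. *)
Lemma sub_cube_eucl_ball x r : 0 < r -> cube x (r / n.+1%:R) `<=` eucl_ball x r.
Proof.
move=> r0 y yx; rewrite /eucl_ball/=.
apply: (@le_lt_trans _ _ (n%:R * (r / n.+1%:R))).
  by apply: eucl_norm_le => i; rewrite !mxE; exact/ltW/yx.
by rewrite mulrCA gtr_pMr// ltr_pdivrMr// mul1r ltr_nat.
Qed.

(** The sigma-algebra is generated by coordinates, so an open set has to be written as a countable
    union of cubes. Those with rational centre and radius [1/(k+1)] contained in [U] suffice: if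
    [1/(k+1) < e/2], a rational point that close to [x] has its cube inside the [e]-neighbourhood of
    [x]. *)
Lemma open_measurable_rV (U : set 'rV[R]_n) : open U ->
  measurable (U : set (borel_rV R n)).
Proof.
move=> oU.
pose c (q : 'rV[rat]_n) : 'rV[R]_n := map_mx ratr q.
pose F (p : 'rV[rat]_n * nat) : set (borel_rV R n) :=
  if `[< cube (c p.1) p.2.+1%:R^-1 `<=` U >] then cube (c p.1) p.2.+1%:R^-1
  else set0.
have -> : U = \bigcup_p F p.
  apply/seteqP; split=> [x Ux|x [p _]]; last first.
    by rewrite /F; case: asboolP => // + xp; exact.
  have [e/= e0 xeU] := (nbhs_ballP _ _).1 (open_nbhs_nbhs (conj oU Ux)).
  pose k := Num.truncn (e / 2)^-1.
  have ke : k.+1%:R^-1 < e / 2.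
    by rewrite invf_plt ?posrE ?divr_gt0// truncnS_gt.
  have k0 : 0 < k.+1%:R^-1 :> R by rewrite invr_gt0.
  have /choice[q xq] i : exists q : rat, `|x ord0 i - ratr q| < k.+1%:R^-1.
    have [|q] := @rat_in_itvoo R (x ord0 i - k.+1%:R^-1) (x ord0 i + k.+1%:R^-1).
      by rewrite ltrD2l gtrN.
    by rewrite in_itv/= -ltr_distlC distrC => h; exists q; rewrite distrC.
  have qx y : cube (c (\row_i q i)) k.+1%:R^-1 y -> U y.
    move=> qy; apply: xeU; split=> // i j; rewrite (ord1 i) /ball/=.
    have := qy j; rewrite !mxE => yq.
    rewrite (@le_lt_trans _ _ (`|x ord0 j - ratr (q j)| + `|y ord0 j - ratr (q j)|))//.
      by rewrite (distrC (y ord0 j)) ler_distD.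
    by rewrite (splitr e) ltrD// (lt_trans _ ke).
  exists (\row_i q i, k) => //; rewrite /F/=; case: asboolP => // _ i.
  by rewrite !mxE.
apply: countable_bigcupT_measurable => [|p]; first exact: countableP.
by rewrite /F; case: ifP => _; [exact: measurable_cube|exact: measurable0].
Qed.

Lemma measurable_leb_coord (i : 'I_n) :
  measurable_fun setT (fun x : leb_rV R n => (x : 'rV[R]_n) ord0 i).
Proof.
move=> _ B mB; apply: measurable_borel_leb.
exact: (measurable_rV_coord i measurableT mB).
Qed.

Lemma measurable_eucl_norm_sub d (T : measurableType d) (h1 h2 : T -> leb_rV R n) :
  measurable_fun setT h1 -> measurable_fun setT h2 ->
  measurable_fun setT (fun t => eucl_norm (h1 t - h2 t : 'rV[R]_n)).
Proof.
move=> m1 m2; apply: measurableT_comp => //.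
  by apply: continuous_measurable_fun; exact: sqrt_continuous.
apply: measurable_sum => i; apply: measurable_funX.
rewrite (_ : (fun _ => _) = (fun t => (h1 t : 'rV[R]_n) ord0 i - (h2 t : 'rV[R]_n) ord0 i)).
  apply: measurable_funB.
    exact: (measurableT_comp (measurable_leb_coord i) m1).
  exact: (measurableT_comp (measurable_leb_coord i) m2).
by apply/funext => t; rewrite !mxE.
Qed.

Lemma measurable_eucl_ball x r : measurable (eucl_ball x r : set (leb_rV R n)).
Proof.
have := @measurable_eucl_norm_sub _ (leb_rV R n) id (cst x)
  (@measurable_id _ _ _) (@measurable_cst _ _ _ _ _ _).
move=> /(_ measurableT `]-oo, r[%classic (measurable_itv _)); rewrite setTI.
by congr measurable; apply/seteqP; split=> y /=; rewrite in_itv.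
Qed.

End borel_sets.

(** * Riesz potentials and Riesz capacity *)

(** The integral of a nonnegative function is a supremum over simple functions below it, hence
    monotone without measurability. In particular capacities of superlevel sets can be compared
    under the integral sign as they are. *)
Lemma ge0_le_integral_nomeas d (T : measurableType d) (R : realType)
    (mu : {measure set T -> \bar R}) (D : set T) (f g : T -> \bar R) :
  (forall x, D x -> (0 <= f x)%E) -> (forall x, D x -> (f x <= g x)%E) ->
  (\int[mu]_(x in D) f x <= \int[mu]_(x in D) g x)%E.
Proof.
move=> f0 fg.
have g0 x : D x -> (0 <= g x)%E by move=> Dx; apply: le_trans (fg x Dx); exact: f0.
rewrite !ge0_integralE//; apply: ereal_sup_le => _ [h hf <-]; exists h => //.
move=> x; apply: le_trans (hf x) _; rewrite /patch; case: ifPn => // /set_mem.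
exact: fg.
Qed.

Lemma le_nneseries_term (R : realType) (f : nat -> \bar R) k :
  (forall i, (0 <= f i)%E) -> (f k <= \sum_(i <oo) f i)%E.
Proof.
move=> f0; rewrite (@nneseriesD1 _ f k xpredT)// leeDl//.
exact: nneseries_ge0.
Qed.

Section riesz.
Context {R : realType} {n : nat}.
Variable alpha : R.
Implicit Types x y : 'rV[R]_n.
Let rc := @riesz_const R n alpha.

Lemma riesz_const_ge0 : 0 <= rc.
Proof.
have G0 (z : R) : 0 <= Gamma z.
  apply: Rintegral_ge0 => t _.
  by rewrite mulr_ge0 ?powR_ge0 ?expR_ge0.
by rewrite /rc /riesz_const divr_ge0 ?mulr_ge0 ?powR_ge0.
Qed.

Lemma riesz_kernel_ge0 x : (0 <= riesz_kernel alpha x)%E.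
Proof.
rewrite /riesz_kernel mule_ge0// ?lee_fin ?invr_ge0 ?riesz_const_ge0//.
by rewrite inve_ge0 lee_fin powR_ge0.
Qed.

Lemma riesz_potential_ge0 phi x : (forall y, 0 <= phi y) ->
  (0 <= riesz_potential alpha phi x)%E.
Proof.
move=> p0; apply: integral_ge0 => y _.
by rewrite mule_ge0 ?riesz_kernel_ge0 ?lee_fin.
Qed.

Lemma riesz_kernelC x y : riesz_kernel alpha (x - y) = riesz_kernel alpha (y - x).
Proof. by rewrite /riesz_kernel eucl_normC. Qed.

Hypothesis alphan : alpha < n%:R.

(** The product with [+oo] is left as it stands: at the origin the kernel is [+oo] for a positive
    constant and 0 for a vanishing one. *)
Lemma riesz_kernelE x : riesz_kernel alpha x =
  if eucl_norm x == 0 then (rc^-1%:E * +oo)%E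
  else (rc^-1 * eucl_norm x `^ (alpha - n%:R))%:E.
Proof.
rewrite /riesz_kernel inver powR_eq0 subr_eq0 (gt_eqF alphan) andbT.
by case: ifP => // _; rewrite EFinM -powRN opprB.
Qed.

Lemma measurable_riesz_kernel d (T : measurableType d) (h1 h2 : T -> leb_rV R n) :
  measurable_fun setT h1 -> measurable_fun setT h2 ->
  measurable_fun setT (fun t => riesz_kernel alpha (h1 t - h2 t : 'rV[R]_n)).
Proof.
move=> m1 m2; have me := measurable_eucl_norm_sub m1 m2.
under eq_fun do rewrite riesz_kernelE.
apply: measurable_fun_ifT => //.
- by apply: measurable_fun_eqr.
- apply/measurable_EFinP; apply: measurable_funM => //.
  exact: (measurableT_comp (measurable_powR _)).
Qed.

Lemma measurable_riesz_integrand (phi : leb_rV R n -> R) x :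
  measurable_fun setT phi ->
  measurable_fun setT (fun y : leb_rV R n =>
    (riesz_kernel alpha (x - (y : 'rV[R]_n)) * (phi y)%:E)%E).
Proof.
move=> mp; apply: emeasurable_funM; last exact/measurable_EFinP.
exact: (@measurable_riesz_kernel _ (leb_rV R n) (cst x) id).
Qed.

(** Domination is asked almost everywhere only, because the [s]-th root of a series built for
    countable subadditivity may fail to dominate on the null set where the series diverges. *)
Lemma le_riesz_potential (phi psi : leb_rV R n -> R) x :
  measurable_fun setT phi -> measurable_fun setT psi ->
  (forall y, 0 <= phi y) -> (forall y, 0 <= psi y) ->
  {ae lebesgue_rV n, forall y, phi y <= psi y} ->
  (riesz_potential alpha phi x <= riesz_potential alpha psi x)%E.
Proof.
move=> m1 m2 p1 p2 le; apply: ae_ge0_le_integral.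
- exact: measurableT.
- by move=> y _; rewrite mule_ge0 ?riesz_kernel_ge0 ?lee_fin.
- exact: measurable_riesz_integrand.
- by move=> y _; rewrite mule_ge0 ?riesz_kernel_ge0 ?lee_fin.
- exact: measurable_riesz_integrand.
apply: (filterS (Filter := ae_filter_ringOfSetsType (lebesgue_rV n))) le => y le _.
apply: lee_wpmul2l; last by rewrite lee_fin.
exact: riesz_kernel_ge0.
Qed.

Lemma riesz_potentialZ (phi : leb_rV R n -> R) (k : R) x :
  measurable_fun setT phi -> (forall y, 0 <= phi y) -> 0 <= k ->
  riesz_potential alpha (fun y => k * phi y) x =
  (k%:E * riesz_potential alpha phi x)%E.
Proof.
move=> mp p0 k0; rewrite -ge0_integralZl_EFin.
- by apply: eq_integral => y _; rewrite EFinM muleCA.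
- exact: measurableT.
- by move=> y _; rewrite mule_ge0 ?riesz_kernel_ge0 ?lee_fin.
- exact: measurable_riesz_integrand.
- exact: k0.
Qed.

End riesz.

(** * Capacity as an infimum of energies, countable subadditivity *)

Section capacity.
Context {R : realType} {n : nat}.
Variables alpha s : R.
Hypothesis s1 : 1 < s.
Implicit Types (x y : 'rV[R]_n) (E : set 'rV[R]_n).

Definition admissible E (phi : leb_rV R n -> R) :=
  [/\ measurable_fun setT phi, forall x, 0 <= phi x &
      forall x, E x -> (1 <= riesz_potential alpha phi x)%E].

Definition energy (phi : leb_rV R n -> R) : \bar R :=
  (\int[lebesgue_rV n]_y (phi y `^ s)%:E)%E.

Let s0 : 0 < s. Proof. exact: lt_trans s1. Qed.

Lemma energy_ge0 phi : (0 <= energy phi)%E.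
Proof. by apply: integral_ge0 => y _; rewrite lee_fin powR_ge0. Qed.

Lemma measurable_energy (phi : leb_rV R n -> R) : measurable_fun setT phi ->
  measurable_fun setT (fun y : leb_rV R n => (phi y `^ s)%:E).
Proof.
by move=> mp; apply/measurable_EFinP; exact: (measurableT_comp (measurable_powR _) mp).
Qed.

Lemma energyZ (phi : leb_rV R n -> R) k : measurable_fun setT phi ->
  (forall y, 0 <= phi y) -> 0 <= k ->
  energy (fun y => k * phi y) = ((k `^ s)%:E * energy phi)%E.
Proof.
move=> mp p0 k0; rewrite /energy -ge0_integralZl_EFin.
- by apply: eq_integral => y _; rewrite -EFinM powRM.
- exact: measurableT.
- by move=> y _; rewrite lee_fin powR_ge0.
- exact: measurable_energy.
- exact: powR_ge0.
Qed.

Lemma riesz_capE E :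
  riesz_cap alpha s E = ereal_inf [set energy phi | phi in admissible E].
Proof.
rewrite /riesz_cap; congr ereal_inf; apply/seteqP; split=> _ [phi [m p0 h] <-];
  exists phi; [exact: And3 m p0 h| |exact: And3 m p0 h|];
  (rewrite powR_Lnorm; last exact: lt0r_neq0 s0);
  by apply: eq_integral => y _; rewrite /= ger0_norm.
Qed.

Lemma riesz_cap_ge0 E : (0 <= riesz_cap alpha s E)%E.
Proof. by rewrite riesz_capE; apply: le_ereal_inf_tmp => _ [phi _ <-]; exact: energy_ge0. Qed.

Lemma riesz_cap_le E phi : admissible E phi -> (riesz_cap alpha s E <= energy phi)%E.
Proof. by move=> h; rewrite riesz_capE; apply: ereal_inf_lbound; exists phi. Qed.

Lemma riesz_cap_lt E c : (riesz_cap alpha s E < c)%E ->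
  exists2 phi, admissible E phi & (energy phi < c)%E.
Proof. by rewrite riesz_capE => /ereal_inf_lt[_ [phi h <-]]; exists phi. Qed.

Lemma le_riesz_cap E1 E2 : E1 `<=` E2 -> (riesz_cap alpha s E1 <= riesz_cap alpha s E2)%E.
Proof.
move=> E12; rewrite !riesz_capE; apply: ereal_inf_le_tmp => _ [phi [m p h] <-].
by exists phi => //; split=> // x /E12; exact: h.
Qed.

Lemma riesz_cap0 : riesz_cap alpha s (set0 : set 'rV[R]_n) = 0%E.
Proof.
apply/eqP; rewrite eq_le riesz_cap_ge0 andbT.
have : admissible set0 (cst 0) by split.
move=> /riesz_cap_le/le_trans; apply.
by rewrite /energy integral0_eq// => y _ /=; rewrite powR0 ?gt_eqF.
Qed.

(** Each [phi k] is optimal up to [e / 2^(k+1)], where [e] fits strictly into the gap between the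
    sum and [c]. *)
Lemma riesz_cap_seq_lt (E : nat -> set 'rV[R]_n) c :
  (\sum_(k <oo) riesz_cap alpha s (E k) < c)%E ->
  exists phi : nat -> leb_rV R n -> R,
    (forall k, admissible (E k) (phi k)) /\ (\sum_(k <oo) energy (phi k) < c)%E.
Proof.
move=> lec.
have sum_ge0 : (0 <= \sum_(k <oo) riesz_cap alpha s (E k))%E.
  by apply: nneseries_ge0 => k _ _; exact: riesz_cap_ge0.
have [e e0 ec] : exists2 e : R, 0 < e & (\sum_(k <oo) riesz_cap alpha s (E k) + e%:E < c)%E.
  case: c lec => [c| |] lec; last by rewrite ltNge leNye in lec.
    have : (\sum_(k <oo) riesz_cap alpha s (E k))%E \is a fin_num.
      by rewrite ge0_fin_numE// (lt_trans lec)// ltry.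
    move: lec; case: (\sum_(k <oo) _)%E => // a ac _; rewrite lte_fin in ac.
    exists ((c - a) / 2); first by rewrite divr_gt0 ?subr_gt0.
    by rewrite -EFinD lte_fin; lra.
  by exists 1 => //; rewrite lte_add_pinfty// ltry.
have cfin k : riesz_cap alpha s (E k) \is a fin_num.
  rewrite ge0_fin_numE ?riesz_cap_ge0//.
  apply: (@le_lt_trans _ _ (\sum_(k <oo) riesz_cap alpha s (E k))%E).
    by apply: (@le_nneseries_term _ (riesz_cap alpha s \o E)) => i; exact: riesz_cap_ge0.
  by rewrite (lt_le_trans lec) ?leey.
have /choice[phi hphi] k : exists phi, admissible (E k) phi /\
    (energy phi < riesz_cap alpha s (E k) + (e / (2 ^ k.+1)%:R)%:E)%E.
  have [|phi ? ?] := @riesz_cap_lt (E k) (riesz_cap alpha s (E k) + (e / (2 ^ k.+1)%:R)%:E)%E.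
    by rewrite lteDl// lte_fin divr_gt0// ltr0n expn_gt0.
  by exists phi.
exists phi; split=> [k|]; first by case: (hphi k).
apply: le_lt_trans ec.
apply: le_trans (epsilon_trick _ (fun k => riesz_cap_ge0 (E k)) (ltW e0)).
apply: lee_nneseries => [k _ _|k _]; first exact: energy_ge0.
by apply/ltW; case: (hphi k).
Qed.

Hypothesis alphan : alpha < n%:R.

(** The [s]-th root of [\sum_k phi k ^ s] dominates every [phi k], so it is admissible for the
    union, and its energy is at most the sum of the energies. *)
Lemma riesz_cap_sigma_subadditive (E : nat -> set 'rV[R]_n) :
  (riesz_cap alpha s (\bigcup_k E k) <= \sum_(k <oo) riesz_cap alpha s (E k))%E.
Proof.
apply/lee_addgt0Pr => e e0.
have [->|lty] := eqVneq (\sum_(k <oo) riesz_cap alpha s (E k))%E +oo%E.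
  by rewrite addye// leey.
have sfin : (\sum_(k <oo) riesz_cap alpha s (E k))%E \is a fin_num.
  rewrite ge0_fin_numE ?ltey//.
  by apply: nneseries_ge0 => k _ _; exact: riesz_cap_ge0.
have [|phi [aphi ephi]] := @riesz_cap_seq_lt E (\sum_(k <oo) riesz_cap alpha s (E k) + e%:E)%E.
  by rewrite lteDl.
pose S (y : leb_rV R n) := (\sum_(k <oo) (phi k y `^ s)%:E)%E.
have S0 y : (0 <= S y)%E by apply: nneseries_ge0 => k _ _; rewrite lee_fin powR_ge0.
have mphi k : measurable_fun setT (fun y : leb_rV R n => (phi k y `^ s)%:E).
  by apply: measurable_energy; case: (aphi k).
have mS : measurable_fun setT S.
  apply: ge0_emeasurable_sum => [k y _ _|k _]; first by rewrite lee_fin powR_ge0.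
  exact: mphi.
have int_S : (\int[lebesgue_rV n]_y S y = \sum_(k <oo) energy (phi k))%E.
  rewrite /S integral_nneseries; [by []|exact: measurableT|exact: mphi|].
  by move=> k y _; rewrite lee_fin powR_ge0.
have Sfin : {ae lebesgue_rV n, forall y, S y \is a fin_num}.
  have : {ae lebesgue_rV n, forall y, setT y -> S y \is a fin_num}.
    apply: integrable_ae; first exact: measurableT.
    apply/integrableP; split; first exact: mS.
    rewrite (eq_integral S) => [|y _]; last by rewrite gee0_abs.
    by rewrite int_S (lt_le_trans ephi) ?leey.
  by apply: (filterS (Filter := ae_filter_ringOfSetsType (lebesgue_rV n))) => y; exact.
(* [fine] sends [+oo] to 0, so [psi] is known to dominate [phi k] only where [S] is finite, that is
   almost everywhere. *)
pose psi (y : leb_rV R n) := fine (S y) `^ s^-1.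
have mpsi : measurable_fun setT psi.
  have mf : measurable_fun setT (fine \o S).
    by apply: measurableT_comp; [exact: fine_measurable|exact: mS].
  exact: (measurableT_comp (measurable_powR _) mf).
have psi0 y : 0 <= psi y by exact: powR_ge0.
have admpsi : admissible (\bigcup_k E k) psi.
  split=> // x [k _ Ekx]; have [mk k0 h] := aphi k.
  apply: le_trans (h x Ekx) _; apply: le_riesz_potential => //.
  apply: (filterS (Filter := ae_filter_ringOfSetsType (lebesgue_rV n))) Sfin => y Sy.
  have kS : phi k y `^ s <= fine (S y).
    rewrite -lee_fin fineK//.
    by apply: (@le_nneseries_term _ (fun k => (phi k y `^ s)%:E)) => i; rewrite lee_fin powR_ge0.
  rewrite /psi -[leLHS]powRr1// -(divff (lt0r_neq0 s0)) powRrM.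
  apply: ge0_ler_powR; rewrite ?nnegrE.
  - by rewrite invr_ge0 ltW.
  - exact: powR_ge0.
  - exact: fine_ge0.
  - exact: kS.
apply: le_trans (riesz_cap_le admpsi) _.
apply: le_trans (ltW ephi); rewrite -int_S; apply: ge0_le_integral_nomeas.
  by move=> y _; rewrite lee_fin powR_ge0.
move=> y _; rewrite /psi -powRrM mulVf ?gt_eqF// powRr1 ?fine_ge0//.
have := S0 y; case: (S y) => [a| |]//= _; exact: leey.
Qed.

Lemma riesz_capU E1 E2 :
  (riesz_cap alpha s (E1 `|` E2) <= riesz_cap alpha s E1 + riesz_cap alpha s E2)%E.
Proof.
pose E k := if k is 0%N then E1 else if k is 1%N then E2 else set0.
have := riesz_cap_sigma_subadditive E.
have -> : \bigcup_k E k = E1 `|` E2.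
  apply/seteqP; split=> [x [[|[|k]]]//= _ h|x [h|h]]; [by left|by right| |].
    by exists 0%N.
  by exists 1%N.
rewrite (nneseries_split_cond 0 2) => [|j _]; last exact: riesz_cap_ge0.
rewrite !big_nat_recr//= big_geq// add0e eseries0 ?adde0// => -[|[|k]]// _ _.
exact: riesz_cap0.
Qed.

End capacity.

(** * Integrals of the kernel *)

Section tonelli.
Context {R : realType} {n : nat}.
Variable f : leb_rV R n * leb_rV R n -> \bar R.
Hypotheses (mf : measurable_fun setT f) (f0 : forall p, (0 <= f p)%E).

Lemma measurable_integral_rV :
  measurable_fun setT (fun y => \int[lebesgue_rV n]_z f (y, z))%E.
Proof. exact: (measurable_fun_fubini_tonelli_F (m2 := sf_lebesgue n)). Qed.

Lemma tonelli_rV :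
  (\int[lebesgue_rV n]_y \int[lebesgue_rV n]_z f (y, z) =
   \int[lebesgue_rV n]_z \int[lebesgue_rV n]_y f (y, z))%E.
Proof. exact: (fubini_tonelli (m1 := sf_lebesgue n) (m2 := sf_lebesgue n)). Qed.

End tonelli.

Section dyadic_shells.
Context {R : realType} {n : nat}.
Implicit Types x y z : 'rV[R]_n.

Lemma dyadic_bracket (t : R) : 1 <= t -> exists k : nat, 2 ^+ k <= t < 2 ^+ k.+1.
Proof.
move=> t1.
have ex : exists k : nat, t < 2 ^+ k.
  exists (Num.truncn t).+1; apply: lt_trans (truncnS_gt t) _.
  by rewrite -natrX ltr_nat ltn_expl.
case: (ex_minnP ex) => -[|k] tk mink; first by move: tk; rewrite expr0 ltNge t1.
exists k; rewrite tk andbT leNgt; apply/negP => /mink.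
by rewrite ltnn.
Qed.

Lemma powR_expr (a b : R) k : 0 <= a -> (a ^+ k) `^ b = (a `^ b) ^+ k.
Proof.
by move=> a0; rewrite -(powR_mulrn k a0) -(powR_mulrn k (powR_ge0 _ _)) powRAC.
Qed.

Lemma lt1_powR (a b : R) : 0 < a -> a < 1 -> 0 < b -> a `^ b < 1.
Proof.
move=> a0 a1 b0; have := @gt0_ltr_powR R b b0 a 1.
by rewrite powR1; apply; rewrite ?nnegrE ?(ltW a0).
Qed.

Lemma ler_npowR (a b c : R) : 0 < a -> a <= b -> 0 <= c -> b `^ (- c) <= a `^ (- c).
Proof.
move=> a0 ab c0; have b0 := lt_le_trans a0 ab.
by rewrite !powRN lef_pV2 ?posrE ?powR_gt0// ge0_ler_powR// nnegrE ltW.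
Qed.

Hypothesis n0 : (0 < n)%N.

Lemma measurable_set1_rV z : measurable ([set z] : set (leb_rV R n)).
Proof.
have -> : [set z] = \bigcap_(k in [set: nat]) cube z k.+1%:R^-1.
  apply/seteqP; split=> [y -> k _ i|y yz]; first by rewrite subrr normr0 invr_gt0.
  apply/rowP => i; apply/eqP; rewrite -subr_eq0 -normr_eq0 eq_le normr_ge0 andbT.
  apply/ler_addgt0Pr => e e0; rewrite add0r.
  have := yz (Num.truncn e^-1) I i => /ltW/le_trans; apply.
  by rewrite invf_ple ?posrE// ltW// truncnS_gt.
by apply: bigcapT_measurable => k; exact: measurable_cube_leb.
Qed.

Lemma lebesgue_rV_set1 z : lebesgue_rV n [set z] = 0%E.
Proof.
apply/eqP; rewrite eq_le measure_ge0 andbT; apply/lee_addgt0Pr => e e0.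
(* Since [n] is positive, [2 d <= 1] gives [(2 d)^n <= 2 d], which is at most [e]. *)
rewrite add0e; pose d := Num.min (e / 2) 2^-1.
have d0 : 0 < d by rewrite lt_min divr_gt0/=.
have zd : [set z] `<=` cube z d by move=> y -> i; rewrite subrr normr0.
apply: (@le_trans _ _ (lebesgue_rV n (cube z d))).
  apply: le_measure => //; rewrite inE; first exact: measurable_set1_rV.
  exact: measurable_cube_leb.
rewrite lebesgue_rV_cube ?(ltW d0)// lee_fin.
have d2 : d *+ 2 <= 1.
  by rewrite -mulr_natr -ler_pdivlMr// mul1r ge_min lexx orbT.
apply: (@le_trans _ _ (d *+ 2)).
  by rewrite -[leRHS]expr1 ler_wiXn2l ?mulrn_wge0// ltW.
by rewrite -mulr_natr -ler_pdivlMr// ge_min lexx.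
Qed.

(* The series of the constants [c k] on the cubes of half-side [rho k] dominates
   [F] almost everywhere on [A], and its terms have geometric integrals. *)
Lemma integral_shells_le (A : set (leb_rV R n)) (F : leb_rV R n -> \bar R) z
    (rho c : nat -> R) (M q : R) :
  measurable A -> measurable_fun setT F -> (forall y, 0 <= F y)%E ->
  (forall k, 0 <= rho k) -> (forall k, 0 <= c k) -> 0 <= q < 1 ->
  (forall k, c k * (rho k *+ 2) ^+ n <= M * q ^+ k) ->
  (forall y, A y -> y <> z -> exists k, cube z (rho k) y /\ (F y <= (c k)%:E)%E) ->
  (\int[lebesgue_rV n]_(y in A) F y <= (M / (1 - q))%:E)%E.
Proof.
move=> mA mF F0 rho0 c0 /andP[q0 q1] Mq cov.
pose G k (y : leb_rV R n) := ((c k)%:E * (\1_(cube z (rho k)) y)%:E)%E.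
have mI k : measurable_fun setT
    (fun y : leb_rV R n => (\1_(cube z (rho k)) y)%:E : \bar R).
  by apply/measurable_EFinP/measurable_indic; exact: measurable_cube_leb.
have mG k : measurable_fun setT (G k) by apply: measurable_funeM; exact: mI.
have G0 k y : (0 <= G k y)%E by rewrite mule_ge0// lee_fin.
have intG k : (\int[lebesgue_rV n]_y G k y = (c k * (rho k *+ 2) ^+ n)%:E)%E.
  rewrite integralZl_rV; [|exact: mI|by move=> y; rewrite lee_fin|exact: c0].
  rewrite integral_indic ?setIT//; last exact: measurable_cube_leb.
  by rewrite lebesgue_rV_cube// EFinM.
apply: (@le_trans _ _ (\int[lebesgue_rV n]_y (\sum_(k <oo) G k y))%E).
  rewrite integral_mkcond; apply: ae_ge0_le_integral.
  - exact: measurableT.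
  - by move=> y _; apply: erestrict_ge0.
  - by apply/(measurable_restrictT _ mA); exact: measurable_funTS.
  - by move=> y _; apply: nneseries_ge0.
  - by apply: ge0_emeasurable_sum => [k y _ _|k _]; [exact: G0|exact: mG].
  exists [set z]; split.
  - exact: measurable_set1_rV.
  - exact: lebesgue_rV_set1.
  move=> y /= /contra_notP; apply => yz _.
  rewrite patchE; case: ifPn => [/set_mem Ay|_]; last exact: nneseries_ge0.
  have [k [ky Fk]] := cov y Ay yz; apply: le_trans Fk _.
  rewrite (nneseries_split_cond 0 k.+1)// big_nat_recr//= -addeA.
  rewrite {2}/G indicE mem_set// mule1 addeCA leeDl// adde_ge0// ?sume_ge0//.
  exact: nneseries_ge0.
rewrite integral_series_rV//.
have cs : series (geometric M q) @ \oo --> M / (1 - q).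
  by apply: cvg_geometric_series; rewrite ger0_norm.
have -> : (M / (1 - q))%:E = (\sum_(k <oo) (M * q ^+ k)%:E)%E.
  apply/esym/cvg_lim => //; rewrite (_ : (fun _ => _) = EFin \o series (geometric M q)).
    by apply: cvg_EFin; [exact: nearW|exact: cs].
  by apply/funext => k /=; rewrite -sumEFin.
apply: lee_nneseries => [k _ _|k _]; last by rewrite intG lee_fin.
exact: integral_ge0.
Qed.

End dyadic_shells.

Section kernel_integrals.
Context {R : realType} {n : nat}.
Variable alpha : R.
Hypotheses (alpha0 : 0 < alpha) (alphan : alpha < n%:R).
Implicit Types x y z : 'rV[R]_n.
Let K := (@riesz_const R n alpha)^-1.
Hypothesis K0 : 0 < K.

Let n0 : (0 < n)%N.
Proof. by rewrite -(ltr_nat R) (lt_trans alpha0). Qed.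

Lemma measurable_kernel_rV z : measurable_fun setT
  (fun y : leb_rV R n => riesz_kernel alpha ((y : 'rV[R]_n) - z)).
Proof. exact: (@measurable_riesz_kernel _ _ _ alphan _ (leb_rV R n) id (cst z)). Qed.

Lemma measurable_norm_rV z : measurable_fun setT
  (fun y : leb_rV R n => eucl_norm ((y : 'rV[R]_n) - z)).
Proof. exact: (@measurable_eucl_norm_sub _ _ _ (leb_rV R n) id (cst z)). Qed.

(** At distance about [rho 2^-k] the kernel has size [(rho 2^-k)^(alpha - n)] on a set of volume
    [(rho 2^-k)^n]: the shells sum to a geometric series of ratio [2^-alpha]. *)
Lemma integral_riesz_kernel_near : exists2 C : R, 0 < C &
  forall z rho, 0 < rho ->
  (\int[lebesgue_rV n]_(y in eucl_ball z rho) riesz_kernel alpha (y - z)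
   <= (C * rho `^ alpha)%:E)%E.
Proof.
pose gamma := n%:R - alpha; have gamma0 : 0 < gamma by rewrite subr_gt0.
pose q : R := 2^-1 `^ alpha.
have q1 : q < 1 by apply: lt1_powR => //; rewrite invf_lt1// ltr1n.
exists (K * 2 `^ gamma * 4 ^+ n / (1 - q)).
  by rewrite divr_gt0 ?subr_gt0// !mulr_gt0// ?powR_gt0 ?exprn_gt0.
move=> z rho rho0.
(* On the shell [k] the distance to [z] lies between [rho 2^-k / 2] and [rho 2^-k]. The lower end
   bounds the kernel in [c]; doubling the upper end places the shell in an open cube. *)
pose rh k : R := 2 * rho * 2^-1 ^+ k.
pose c k : R := K * (rho / 2 * 2^-1 ^+ k) `^ (- gamma).
have -> : K * 2 `^ gamma * 4 ^+ n / (1 - q) * rho `^ alpha =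
    K * (rho `^ (- gamma) * 2 `^ gamma) * (4 * rho) ^+ n / (1 - q).
  have -> : rho `^ alpha = rho `^ (- gamma) * rho ^+ n.
    rewrite -powR_mulrn ?(ltW rho0)// -powRD; first by congr (_ `^ _); rewrite /gamma; ring.
    by rewrite (gt_eqF rho0) implybT.
  by rewrite exprMn; field; rewrite subr_eq0 gt_eqF.
apply: (@integral_shells_le _ _ n0 _ _ z rh c).
- exact: measurable_eucl_ball.
- exact: measurable_kernel_rV.
- by move=> y; exact: riesz_kernel_ge0.
- by move=> k; rewrite !mulr_ge0 ?exprn_ge0 ?invr_ge0 ?(ltW rho0).
- by move=> k; rewrite mulr_ge0 ?powR_ge0 ?(ltW K0).
- by rewrite powR_ge0 q1.
- move=> k; rewrite /c /rh le_eqVlt; apply/orP; left; apply/eqP.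
  rewrite !powRM ?invr_ge0 ?exprn_ge0 ?mulr_ge0 ?(ltW rho0) ?invr_ge0//.
  rewrite !powR_expr ?invr_ge0//.
  have -> : 2^-1 `^ (- gamma) = 2 `^ gamma :> R.
    by rewrite -[2^-1]powR_inv1// -powRrM mulN1r opprK.
  have -> : q = 2 `^ gamma * 2^-1 ^+ n.
    rewrite /q -[2^-1 in RHS]powR_inv1// -[_ ^+ n]powR_mulrn ?powR_ge0// -powRrM.
    rewrite -powRD ?pnatr_eq0 ?implybT// -[2^-1 in LHS]powR_inv1// -powRrM.
    by congr (_ `^ _); rewrite /gamma; ring.
  have -> : 2 * rho * 2^-1 ^+ k *+ 2 = (4 * rho) * 2^-1 ^+ k by ring.
  by rewrite !exprMn -!exprM (mulnC k n); ring.
move=> y yz yNz.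
have e0 : 0 < eucl_norm (y - z).
  by rewrite lt_def eucl_norm_ge0 andbT eucl_norm_sub_eq0; apply/eqP.
have [|k /andP[k1 k2]] := @dyadic_bracket R (rho / eucl_norm (y - z)).
  by rewrite ler_pdivlMr// mul1r ltW.
have h0 : 0 < 2 ^+ k :> R by rewrite exprn_gt0.
exists k; split.
  move=> i; apply: (@le_lt_trans _ _ (eucl_norm (y - z))).
    by have := coord_le_eucl_norm (y - z) i; rewrite !mxE.
  apply: (@le_lt_trans _ _ (rho * 2^-1 ^+ k)).
    by rewrite exprVn ler_pdivlMr// mulrC -ler_pdivlMr.
  rewrite /rh -(mulrA 2) -[ltLHS]mul1r ltr_pM2r ?ltr1n//.
  by rewrite mulr_gt0 ?exprn_gt0 ?invr_gt0.
rewrite riesz_kernelE// gt_eqF// lee_fin ler_wpM2l ?(ltW K0)//.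
rewrite -[alpha - n%:R]opprB -/gamma.
apply: ler_npowR; [|idtac|exact: ltW gamma0].
  by rewrite mulr_gt0 ?divr_gt0 ?exprn_gt0 ?invr_gt0.
move: k2; rewrite ltr_pdivrMr// => k2; apply/ltW.
by rewrite exprVn -mulrA -invfM -exprS ltr_pdivrMr ?exprn_gt0// mulrC.
Qed.

(** The same decomposition run outwards, with ratio [2^(n - beta)], which is below 1 exactly because
    [beta] exceeds the dimension. *)
Lemma integral_norm_powR_tail (beta : R) : n%:R < beta -> exists2 C : R, 0 < C &
  forall z r, 0 < r ->
  (\int[lebesgue_rV n]_(y in ~` eucl_ball z r) (eucl_norm (y - z) `^ (- beta))%:E
   <= (C * r `^ (n%:R - beta))%:E)%E.
Proof.
move=> nbeta; pose q : R := 2 `^ (n%:R - beta).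
have beta0 : 0 <= beta by rewrite (le_trans _ (ltW nbeta)).
have q1 : q < 1.
  rewrite /q -[2]invrK -[_^-1^-1]powR_inv1 ?invr_ge0// -powRrM mulN1r opprB.
  by apply: lt1_powR; rewrite ?subr_gt0// invf_lt1// ltr1n.
exists (4 ^+ n / (1 - q)); first by rewrite divr_gt0 ?subr_gt0 ?exprn_gt0.
move=> z r r0.
pose rh k : R := r * 2 ^+ k.+1.
pose c k : R := (r * 2 ^+ k) `^ (- beta).
have -> : 4 ^+ n / (1 - q) * r `^ (n%:R - beta) =
    (r `^ (- beta) * (4 * r) ^+ n) / (1 - q).
  have -> : r `^ (n%:R - beta) = r `^ (- beta) * r ^+ n.
    rewrite -powR_mulrn ?(ltW r0)// -powRD; first by congr (_ `^ _); ring.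
    by rewrite (gt_eqF r0) implybT.
  by rewrite exprMn; field; rewrite subr_eq0 gt_eqF.
apply: (@integral_shells_le _ _ n0 _ _ z rh c).
- by apply: measurableC; exact: measurable_eucl_ball.
- apply/measurable_EFinP.
  exact: (measurableT_comp (measurable_powR _) (measurable_norm_rV z)).
- by move=> y; rewrite lee_fin powR_ge0.
- by move=> k; rewrite mulr_ge0 ?exprn_ge0 ?(ltW r0).
- by move=> k; rewrite powR_ge0.
- by rewrite powR_ge0 q1.
- move=> k; rewrite /c /rh le_eqVlt; apply/orP; left; apply/eqP.
  rewrite powRM ?exprn_ge0 ?(ltW r0)// powR_expr//.
  have -> : q = 2 `^ (- beta) * 2 ^+ n.
    rewrite /q -[_ ^+ n]powR_mulrn// -powRD ?pnatr_eq0 ?implybT//.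
    by congr (_ `^ _); ring.
  have -> : r * 2 ^+ k.+1 *+ 2 = (4 * r) * 2 ^+ k by rewrite exprS; ring.
  by rewrite !exprMn -!exprM (mulnC k n); ring.
move=> y /negP; rewrite -leNgt => yz _.
have e0 : 0 < eucl_norm (y - z) by exact: lt_le_trans yz.
have [|k /andP[k1 k2]] := @dyadic_bracket R (eucl_norm (y - z) / r).
  by rewrite ler_pdivlMr// mul1r.
exists k; split.
  move=> i; apply: (@le_lt_trans _ _ (eucl_norm (y - z))).
    by have := coord_le_eucl_norm (y - z) i; rewrite !mxE.
  by rewrite /rh mulrC -ltr_pdivrMr.
rewrite lee_fin; apply: ler_npowR => //; first by rewrite mulr_gt0 ?exprn_gt0.
by rewrite mulrC -ler_pdivlMr.
Qed.

End kernel_integrals.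

(** * Capacity inside small cubes *)

Section local_estimates.
Context {R : realType} {n : nat}.
Variables alpha s : R.
Hypotheses (alpha0 : 0 < alpha) (alphan : alpha < n%:R) (s1 : 1 < s).
Implicit Types (x y z : 'rV[R]_n) (E : set 'rV[R]_n).
Let K := (@riesz_const R n alpha)^-1.
Hypothesis K0 : 0 < K.
Let N : R := n.+1%:R.

Let s0 : 0 < s. Proof. exact: lt_trans s1. Qed.
Let N0 : 0 < N. Proof. by rewrite ltr0n. Qed.

Lemma riesz_kernel_ge x t : 0 < t -> eucl_norm x <= t ->
  ((K * t `^ (alpha - n%:R))%:E <= riesz_kernel alpha x)%E.
Proof.
move=> t0 xt; rewrite riesz_kernelE//; case: ifPn => [_|xN0].
  by rewrite gt0_muley ?leey ?lte_fin.
have e0 : 0 < eucl_norm x by rewrite lt_def xN0 eucl_norm_ge0.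
rewrite lee_fin ler_wpM2l ?(ltW K0)// -[alpha - n%:R]opprB.
by apply: ler_npowR => //; rewrite subr_ge0 ltW.
Qed.

Lemma energy_indic_cube x r c : 0 <= c -> 0 < r ->
  energy s (fun y : leb_rV R n => c * \1_(cube x r) y) =
  (c `^ s * (r *+ 2) ^+ n)%:E.
Proof.
move=> c0 r0; rewrite energyZ; last 3 first.
- by apply: measurable_indic; exact: measurable_cube_leb.
- by move=> y; rewrite indicE.
- exact: c0.
rewrite EFinM -(lebesgue_rV_cube x (ltW r0)); congr (_ * _)%E.
rewrite -[cube x r]setIT -integral_indic ?setIT//; last exact: measurable_cube_leb.
apply: eq_integral => y _; rewrite indicE.
by case: (y \in _); rewrite ?powR1// powR0// gt_eqF.
Qed.

(** A multiple [c] of the indicator of the cube is a competitor. Points of the cube are at distance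
    at most [2 N r], so its potential there is at least [c K (2 N r)^(alpha - n) (2 r)^n], of order
    [c r^alpha]. [A] is chosen to make this equal to 1, and the energy [c^s (2 r)^n] then has order
    [r^(n - alpha s)]. *)
Lemma riesz_cap_cube_le : exists2 C : R, 0 < C & forall x r, 0 < r ->
  (riesz_cap alpha s (cube x r) <= (C * r `^ (n%:R - alpha * s))%:E)%E.
Proof.
pose A : R := (K * (2 * N) `^ (alpha - n%:R) * 2 ^+ n)^-1.
have A0 : 0 < A by rewrite invr_gt0 !mulr_gt0 ?powR_gt0 ?exprn_gt0 ?mulr_gt0.
exists (A `^ s * 2 ^+ n); first by rewrite mulr_gt0 ?powR_gt0 ?exprn_gt0.
move=> x r r0; pose c := A * r `^ (- alpha).
have c0 : 0 < c by rewrite mulr_gt0 ?powR_gt0.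
have mI : measurable_fun setT (\1_(cube x r) : leb_rV R n -> R).
  by apply: measurable_indic; exact: measurable_cube_leb.
have I0 (y : leb_rV R n) : 0 <= \1_(cube x r) y :> R by [].
have -> : A `^ s * 2 ^+ n * r `^ (n%:R - alpha * s) = c `^ s * (r *+ 2) ^+ n.
  rewrite /c powRM ?powR_ge0 ?(ltW A0)// -powRrM -[r *+ 2]mulr_natl exprMn.
  rewrite (_ : n%:R - alpha * s = - alpha * s + n%:R); last by ring.
  rewrite powRD; last by rewrite (gt_eqF r0) implybT.
  by rewrite (powR_mulrn _ (ltW r0)); ring.
rewrite -(energy_indic_cube x (ltW c0) r0); apply: (riesz_cap_le s1); split.
- by apply: measurable_funM; [exact: measurable_cst|exact: mI].
- by move=> y; rewrite mulr_ge0 ?(ltW c0).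
move=> y xy; rewrite riesz_potentialZ ?(ltW c0)//.
have -> : 1%:E = (c%:E * ((K * (2 * N * r) `^ (alpha - n%:R))%:E *
    lebesgue_rV n (cube x r)))%E.
  rewrite lebesgue_rV_cube ?(ltW r0)// -!EFinM; congr EFin; rewrite /c /A.
  rewrite -[r *+ 2]mulr_natl exprMn [(2 * N * r) `^ _]powRM ?mulr_ge0 ?(ltW r0)//.
  have -> : r `^ (- alpha) = (r `^ (alpha - n%:R) * r ^+ n)^-1.
    rewrite -(powR_mulrn _ (ltW r0)) -powRD; last by rewrite (gt_eqF r0) implybT.
    by rewrite powRN; congr (_ `^ _)^-1; ring.
  field; rewrite !gt_eqF ?powR_gt0 ?exprn_gt0 ?mulr_gt0//.
rewrite lee_pmul2l ?lte_fin// -[cube x r in leLHS]setIT -integral_indic//; last first.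
  exact: measurable_cube_leb.
rewrite -integralZl_rV; last first.
- by rewrite mulr_ge0 ?powR_ge0 ?(ltW K0).
- by move=> z; rewrite lee_fin.
- exact/measurable_EFinP/mI.
apply: ge0_le_integral_nomeas => z _.
  by rewrite mule_ge0 ?lee_fin ?mulr_ge0 ?powR_ge0 ?(ltW K0).
rewrite indicE; case: (boolP (z \in cube x r)) => [/set_mem xz|_]; last by rewrite !mule0.
rewrite !mule1; apply: riesz_kernel_ge; first by rewrite !mulr_gt0.
apply: (@le_trans _ _ (n%:R * (r + r))).
  apply: eucl_norm_le => i; rewrite !mxE.
  rewrite (le_trans (ler_distD (x ord0 i) _ _))// lerD ?(ltW (xy i))//.
  by rewrite distrC (ltW (xz i)).
have -> : 2 * N * r = N * (r + r) by ring.
by rewrite ler_wpM2r ?addr_ge0 ?(ltW r0)// /N ler_nat.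
Qed.

Lemma integral_mul_indic (A : set (leb_rV R n)) (f : leb_rV R n -> \bar R) :
  (\int[lebesgue_rV n]_y (f y * (\1_A y)%:E) = \int[lebesgue_rV n]_(y in A) f y)%E.
Proof.
rewrite [RHS]integral_mkcond; apply: eq_integral => y _.
by rewrite patchE indicE; case: ifP; rewrite ?mule1 ?mule0.
Qed.

(* Beyond the doubled cube the kernels at [y] and at the centre [x] are
   comparable, so a small potential at [x] leaves only the near part at [y]. *)
Lemma riesz_cap_localize E phi x r : admissible alpha E phi -> 0 < r ->
  (riesz_potential alpha phi x < (2^-1 * (2 * N) `^ (alpha - n%:R))%:E)%E ->
  (riesz_cap alpha s (E `&` cube x r) <=
   (2 `^ s)%:E * \int[lebesgue_rV n]_(y in cube x (2 * r)) (phi y `^ s)%:E)%E.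
Proof.
move=> [mphi phi0 phiE] r0 xsmall.
pose I1 : leb_rV R n -> R := \1_(cube x (2 * r)).
pose I2 : leb_rV R n -> R := \1_(~` cube x (2 * r)).
have mI1 : measurable_fun setT I1.
  by apply: measurable_indic; exact: measurable_cube_leb.
have mI2 : measurable_fun setT I2.
  by apply: measurable_indic; apply: measurableC; exact: measurable_cube_leb.
pose phi1 (y : leb_rV R n) := phi y * I1 y; pose phi2 (y : leb_rV R n) := phi y * I2 y.
have mphi1 : measurable_fun setT phi1 by apply: measurable_funM; [exact: mphi|exact: mI1].
have mphi2 : measurable_fun setT phi2 by apply: measurable_funM; [exact: mphi|exact: mI2].
have phi10 y : 0 <= phi1 y by rewrite mulr_ge0.
have phi20 y : 0 <= phi2 y by rewrite mulr_ge0.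
have phiD y : phi y = phi1 y + phi2 y.
  rewrite /phi1 /phi2 /I1 /I2 !indicE in_setC.
  by case: (y \in _) => /=; rewrite mulr1 mulr0 ?addr0 ?add0r.
have potD y : riesz_potential alpha phi y =
    (riesz_potential alpha phi1 y + riesz_potential alpha phi2 y)%E.
  rewrite /riesz_potential -integralD_rV.
  - by apply: eq_integral => z _; rewrite phiD EFinD ge0_muleDr// lee_fin.
  - exact: measurable_riesz_integrand.
  - by move=> z; rewrite mule_ge0 ?riesz_kernel_ge0 ?lee_fin.
  - exact: measurable_riesz_integrand.
  - by move=> z; rewrite mule_ge0 ?riesz_kernel_ge0 ?lee_fin.
pose L := (2 * N) `^ (n%:R - alpha).
have N2 : (2 * N == 0) = false by rewrite gt_eqF ?mulr_gt0.
have L0 : 0 < L by rewrite powR_gt0 ?mulr_gt0.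
have far y : cube x r y -> (riesz_potential alpha phi2 y < (2^-1)%:E)%E.
  move=> xy; apply: (@le_lt_trans _ _ (L%:E * riesz_potential alpha phi x)%E); last first.
    rewrite -(@lte_pmul2l _ L%:E)// ?lte_fin// in xsmall.
    apply: lt_le_trans xsmall _; rewrite -EFinM lee_fin mulrCA /L -powRD.
      by rewrite addrA subrK subrr powRr0 mulr1.
    by rewrite N2 implybT.
  rewrite /riesz_potential -integralZl_rV; last first.
  - exact: ltW.
  - by move=> z; rewrite mule_ge0 ?riesz_kernel_ge0 ?lee_fin.
  - exact: measurable_riesz_integrand.
  apply: ge0_le_integral_nomeas => z _.
    by rewrite mule_ge0 ?riesz_kernel_ge0 ?lee_fin.
  rewrite /phi2 /I2 indicE; case: (boolP (z \in _)) => [/set_mem xz|_]; last first.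
    rewrite mulr0 mule0; apply: mule_ge0; first by rewrite lee_fin; exact: ltW L0.
    by apply: mule_ge0; [exact: riesz_kernel_ge0|rewrite lee_fin].
  rewrite mulr1 muleA; apply: lee_wpmul2r; first by rewrite lee_fin.
  (* One coordinate of [z] is [2 r] away from [x] while [y] is within [r], so [r] is below the
     distance [e] of [y] and [z]. Every coordinate of [x - z] is therefore at most [2 e], which
     gives the factor [2 N] in the comparison of kernels. *)
  have [i zi] : exists i, 2 * r <= `|z ord0 i - x ord0 i|.
    by apply: contrapT => /forallNP h; apply: xz => i; rewrite ltNge; apply/negP/h.
  pose e := eucl_norm (y - z).
  have re : r < e.
    have := coord_le_eucl_norm (y - z) i; rewrite !mxE -/e => ze.
    have := xy i => yi; have := ler_distD (y ord0 i) (z ord0 i) (x ord0 i).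
    by rewrite (distrC (z ord0 i) (y ord0 i)); lra.
  have e0 : 0 < e by exact: lt_trans re.
  have xze : eucl_norm (x - z) <= 2 * N * e.
    have -> : 2 * N * e = N * (2 * e) by ring.
    apply: (@le_trans _ _ (n%:R * (2 * e))); last first.
      by rewrite ler_wpM2r ?ler_nat// mulr_ge0// ltW.
    apply: eucl_norm_le => j; rewrite !mxE.
    have := coord_le_eucl_norm (y - z) j; rewrite !mxE -/e => ze.
    have := xy j; have := ler_distD (y ord0 j) (x ord0 j) (z ord0 j).
    by rewrite (distrC (x ord0 j) (y ord0 j)); lra.
  rewrite riesz_kernelE// gt_eqF//.
  apply: (@le_trans _ _ (L%:E * (K * (2 * N * e) `^ (alpha - n%:R))%:E)%E).
    rewrite -EFinM lee_fin -/e [(2 * N * e) `^ _]powRM ?mulr_ge0 ?(ltW e0)//.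
    rewrite [leRHS](_ : _ = K * e `^ (alpha - n%:R) * (L * (2 * N) `^ (alpha - n%:R))).
      rewrite /L -powRD; first by rewrite addrA subrK subrr powRr0 mulr1.
      by rewrite N2 implybT.
    by rewrite /L; ring.
  apply: lee_wpmul2l; first by rewrite lee_fin ltW.
  by apply: riesz_kernel_ge => //; rewrite !mulr_gt0.
(* The far part stays below 1/2, so the near part is above 1/2 on the set; doubling it restores
   admissibility and costs the factor [2^s]. *)
have adm : admissible alpha (E `&` cube x r) (fun y => 2 * phi1 y).
  split.
  - by apply: measurable_funM; [exact: measurable_cst|exact: mphi1].
  - by move=> y; rewrite mulr_ge0.
  move=> y [Ey xy]; rewrite riesz_potentialZ//.
  have := phiE y Ey; rewrite potD; have := far y xy.
  have := @riesz_potential_ge0 _ _ alpha phi1 y phi10.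
  have := @riesz_potential_ge0 _ _ alpha phi2 y phi20.
  case: (riesz_potential alpha phi2 y) => // b; rewrite lee_fin => b0.
  case: (riesz_potential alpha phi1 y) => [a| |]//; last by rewrite gt0_muley ?leey ?lte_fin.
  by rewrite -EFinD -EFinM lte_fin !lee_fin => a0; lra.
apply: le_trans (riesz_cap_le s1 adm) _.
rewrite energyZ; [|exact: mphi1|exact: phi10|by []].
apply: lee_wpmul2l; first by rewrite lee_fin powR_ge0.
rewrite -integral_mul_indic; apply: ge0_le_integral_nomeas => y _.
  by rewrite lee_fin powR_ge0.
rewrite /phi1 /I1 indicE; case: (_ \in _); rewrite ?mulr1 ?mule1//.
by rewrite mulr0 mule0 powR0// gt_eqF.
Qed.

End local_estimates.

(** * Lebesgue measure of superlevel sets of potentials *)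

Section superlevel.
Context {R : realType} {n : nat}.
Variables alpha s : R.
Hypotheses (alpha0 : 0 < alpha) (alphan : alpha < n%:R) (s1 : 1 < s).
Hypothesis alphas : alpha * s < n%:R.
Implicit Types (x y z : 'rV[R]_n).
Let K := (@riesz_const R n alpha)^-1.
Hypothesis K0 : 0 < K.

(** A form of Young's inequality: if [u > a], then [u = u^(1-q) u^q] and [u^(1-q) <= a^(1-q)]. The
    parameter [a] is free and is tuned to the scale at each use. *)
Lemma le_weighted_powR (q a u : R) : 1 <= q -> 0 < a -> 0 <= u ->
  u <= a + a `^ (1 - q) * u `^ q.
Proof.
move=> q1 a0 u0; have [ua|au] := leP u a.
  by rewrite (le_trans ua)// lerDl mulr_ge0 ?powR_ge0.
have up : 0 < u by exact: lt_trans au.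
rewrite (@le_trans _ _ (a `^ (1 - q) * u `^ q))//; last by rewrite lerDr ltW.
have {1}-> : u = u `^ (1 - q) * u `^ q.
  by rewrite -powRD ?subrK ?powRr1// (gt_eqF up) implybT.
rewrite ler_wpM2r ?powR_ge0// -[1 - q]opprB.
by apply: ler_npowR; rewrite ?(ltW au)// subr_ge0.
Qed.

Lemma measurable_riesz_potential (phi : leb_rV R n -> R) :
  measurable_fun setT phi -> (forall y, 0 <= phi y) ->
  measurable_fun setT (riesz_potential alpha phi : leb_rV R n -> \bar R).
Proof.
move=> mphi phi0.
pose f (p : leb_rV R n * leb_rV R n) :=
  (riesz_kernel alpha ((p.1 : 'rV[R]_n) - p.2)%R * (phi p.2)%:E)%E.
apply: (@measurable_integral_rV _ _ f) => [|p]; last first.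
  by rewrite /f mule_ge0 ?riesz_kernel_ge0 ?lee_fin.
apply: emeasurable_funM.
  by apply: measurable_riesz_kernel; [exact: alphan|exact: measurable_fst|exact: measurable_snd].
by apply/measurable_EFinP; exact: (measurableT_comp mphi measurable_snd).
Qed.

Section fixed_radius.
Variable r : R.
Hypothesis r0 : 0 < r.

(** The cut at distance [r] sits in the integrand and not in the domain, which keeps the kernel
    jointly measurable on the product and symmetric in its two arguments, as Tonelli requires
    below. *)
Definition near_kernel y z : \bar R :=
  if eucl_norm (y - z) < r then riesz_kernel alpha (y - z) else 0%E.

Definition tail_kernel beta y z : \bar R :=
  if eucl_norm (y - z) < r then 0%E else (eucl_norm (y - z) `^ (- beta))%:E.

Lemma near_kernelC y z : near_kernel y z = near_kernel z y.
Proof. by rewrite /near_kernel eucl_normC riesz_kernelC. Qed.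

Lemma near_kernel_ge0 y z : (0 <= near_kernel y z)%E.
Proof. by rewrite /near_kernel; case: ifP => // _; exact: riesz_kernel_ge0. Qed.

Lemma tail_kernel_ge0 beta y z : (0 <= tail_kernel beta y z)%E.
Proof. by rewrite /tail_kernel; case: ifP => // _; rewrite lee_fin powR_ge0. Qed.

Lemma measurable_near_kernel d (T : measurableType d) (h1 h2 : T -> leb_rV R n) :
  measurable_fun setT h1 -> measurable_fun setT h2 ->
  measurable_fun setT (fun t => near_kernel (h1 t) (h2 t)).
Proof.
move=> m1 m2; apply: measurable_fun_ifT.
- by apply: measurable_fun_ltr; [exact: measurable_eucl_norm_sub|exact: measurable_cst].
- exact: measurable_riesz_kernel.
- exact: measurable_cst.
Qed.

Lemma measurable_tail_kernel beta d (T : measurableType d) (h1 h2 : T -> leb_rV R n) :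
  measurable_fun setT h1 -> measurable_fun setT h2 ->
  measurable_fun setT (fun t => tail_kernel beta (h1 t) (h2 t)).
Proof.
move=> m1 m2; apply: measurable_fun_ifT.
- by apply: measurable_fun_ltr; [exact: measurable_eucl_norm_sub|exact: measurable_cst].
- exact: measurable_cst.
- apply/measurable_EFinP.
  exact: (measurableT_comp (measurable_powR _) (measurable_eucl_norm_sub m1 m2)).
Qed.

Lemma integral_near_kernel y : (\int[lebesgue_rV n]_z near_kernel y z =
  \int[lebesgue_rV n]_(z in eucl_ball y r) riesz_kernel alpha (z - y))%E.
Proof.
rewrite [RHS]integral_mkcond; apply: eq_integral => z _.
rewrite patchE near_kernelC /near_kernel; case: ifPn => h; case: ifPn => //.
  by move/negP => []; rewrite inE.
by rewrite inE => /(elimN idP h).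
Qed.

Lemma integral_tail_kernel beta y : (\int[lebesgue_rV n]_z tail_kernel beta y z =
  \int[lebesgue_rV n]_(z in ~` eucl_ball y r) (eucl_norm (z - y) `^ (- beta))%:E)%E.
Proof.
rewrite [RHS]integral_mkcond; apply: eq_integral => z _.
rewrite patchE in_setC /tail_kernel eucl_normC; case: ifPn => h; case: ifPn => //.
  by move/negP => []; rewrite inE.
by rewrite negbK inE => /(elimN idP h).
Qed.

End fixed_radius.

(** The potential is bounded by [1/4 + J], where [J] is linear in [phi^s]. Where the potential is at
    least 1, [J] is bounded below, so a Chebyshev argument over the cube, with the order of
    integration exchanged, gives the estimate. *)
Lemma riesz_potential_superlevel_le : exists2 C : R, 0 < C &
  forall (phi : leb_rV R n -> R) x r,
    measurable_fun setT phi -> (forall y, 0 <= phi y) -> 0 < r ->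
    (lebesgue_rV n (cube x r `&` [set y | 1 <= riesz_potential alpha phi y]) <=
     (C * r `^ (alpha * s))%:E * energy s phi)%E.
Proof.
have sB0 : 0 < s - 1 by rewrite subr_gt0.
pose theta := (n%:R - alpha) / (s - 1).
have thetaE : theta * (1 - s) = alpha - n%:R.
  by rewrite /theta; field; rewrite gt_eqF.
(* This is [alpha * s < n] rewritten. It means [beta > n], so that the tail integral converges. *)
have alpha_theta : alpha < theta by rewrite /theta ltr_pdivlMr// mulrBr mulr1 ltrD2r.
pose beta := n%:R - alpha + theta.
have [C1 C10 near] := integral_riesz_kernel_near alpha0 alphan K0.
have [|C2 C20 tail] := @integral_norm_powR_tail _ _ alpha alpha0 alphan beta.
  by rewrite /beta; lra.
(* Normalized so that the near and tail errors, [c C1] and [c K C2], add up to 1/4. *)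
pose c := (4 * (C1 + K * C2))^-1.
have c0 : 0 < c by rewrite invr_gt0 mulr_gt0// addr_gt0// mulr_gt0.
pose C3 := c `^ (1 - s) * (C1 + K * 2 ^+ n).
have C30 : 0 < C3.
  by rewrite mulr_gt0 ?powR_gt0// addr_gt0// mulr_gt0 ?exprn_gt0.
exists (2 * C3); first by rewrite mulr_gt0.
move=> phi x r mphi phi0 r0.
(* These powers of [r] cancel [r^alpha] from the near integral and [r^(n - beta)] from the tail
   integral, making the error independent of the scale. *)
pose a0 := c * r `^ (- alpha); pose a1 := c * r `^ (theta - alpha).
have a00 : 0 < a0 by rewrite mulr_gt0 ?powR_gt0.
have a10 : 0 < a1 by rewrite mulr_gt0 ?powR_gt0.
pose b := a0 `^ (1 - s); pose D := K * a1 `^ (1 - s).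
have b0 : 0 <= b by exact: powR_ge0.
have D0 : 0 <= D by rewrite mulr_ge0 ?powR_ge0// ltW.
(* [phi <= a + a `^ (1 - s) * phi `^ s] with [a = a0] near [y], and with [a] equal
   to [a1] times the power [- theta] of the distance elsewhere: the term [a] has
   potential at most 1/4, and the other kernel is the constant [D] far from [y]. *)
have pointwise y z : (riesz_kernel alpha (y - z) * (phi z)%:E <=
    a0%:E * near_kernel r y z + (K * a1)%:E * tail_kernel r beta y z +
    (b%:E * near_kernel r y z + D%:E) * (phi z `^ s)%:E)%E.
  rewrite /near_kernel /tail_kernel; case: ltP => yz.
    rewrite mule0 adde0.
    apply: (@le_trans _ _ (riesz_kernel alpha (y - z) *
        (a0 + b * phi z `^ s)%:E)%E).
      apply: lee_wpmul2l; first exact: riesz_kernel_ge0.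
      by rewrite lee_fin le_weighted_powR// ltW.
    rewrite EFinD ge0_muleDr; last 2 first.
    - by rewrite lee_fin ltW.
    - by rewrite lee_fin mulr_ge0 ?powR_ge0.
    rewrite muleC leeD2l// EFinM muleA [X in (X * _)%E]muleC.
    apply: lee_wpmul2r; first by rewrite lee_fin powR_ge0.
    by rewrite leeDl ?lee_fin.
  have e0 : 0 < eucl_norm (y - z) by exact: lt_le_trans r0 yz.
  rewrite !mule0 !add0e riesz_kernelE// gt_eqF// -!EFinM -EFinD lee_fin -/K.
  set e := eucl_norm (y - z) in e0 *.
  have := @le_weighted_powR s (a1 * e `^ (- theta)) (phi z) (ltW s1).
  rewrite mulr_gt0 ?powR_gt0// => /(_ isT (phi0 z)).
  rewrite powRM ?powR_ge0 ?(ltW a10)// -powRrM mulNr thetaE opprB.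
  move=> /(ler_wpM2l (ltW K0)).
  have eg : 0 <= e `^ (alpha - n%:R) by exact: powR_ge0.
  move=> /(ler_wpM2l eg)/le_trans => h.
  rewrite [leLHS](_ : _ = e `^ (alpha - n%:R) * (K * phi z)); last by ring.
  apply: h; rewrite le_eqVlt; apply/orP; left; apply/eqP.
  have -> : e `^ (- beta) = e `^ (alpha - n%:R) * e `^ (- theta).
    rewrite -powRD; last by rewrite (gt_eqF e0) implybT.
    by congr (_ `^ _); rewrite /beta; ring.
  have ee : e `^ (alpha - n%:R) * e `^ (n%:R - alpha) = 1.
    rewrite -powRD; last by rewrite (gt_eqF e0) implybT.
    by rewrite addrA subrK subrr powRr0.
  rewrite /D mulrDr mulrDr; congr (_ + _); first by ring.
  transitivity (K * a1 `^ (1 - s) * phi z `^ s *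
    (e `^ (alpha - n%:R) * e `^ (n%:R - alpha))); first by ring.
  by rewrite ee mulr1.
pose G (p : leb_rV R n * leb_rV R n) : \bar R :=
  ((b%:E * near_kernel r p.1 p.2 + D%:E) * (phi p.2 `^ s)%:E)%E.
have mG2 d (T : measurableType d) (h1 h2 : T -> leb_rV R n) :
    measurable_fun setT h1 -> measurable_fun setT h2 ->
    measurable_fun setT (fun t => G (h1 t, h2 t)).
  move=> m1 m2; apply: emeasurable_funM; last first.
    apply/measurable_EFinP; apply: (measurableT_comp (measurable_powR _)).
    exact: (measurableT_comp mphi m2).
  apply: emeasurable_funD; last exact: measurable_cst.
  by apply: measurable_funeM; exact: measurable_near_kernel.
have G0 p : (0 <= G p)%E.
  rewrite /G mule_ge0 ?lee_fin ?powR_ge0//.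
  by rewrite adde_ge0 ?lee_fin// mule_ge0 ?near_kernel_ge0.
have mid (T1 := leb_rV R n) : measurable_fun setT (id : T1 -> T1).
  exact: measurable_id.
pose J y := (\int[lebesgue_rV n]_z G (y, z))%E.
have J0 y : (0 <= J y)%E by exact: integral_ge0.
have nearI y : (\int[lebesgue_rV n]_z near_kernel r y z <= (C1 * r `^ alpha)%:E)%E.
  by rewrite integral_near_kernel; exact: near.
have pot_le y : (riesz_potential alpha phi y <= (4^-1)%:E + J y)%E.
  have mnear : measurable_fun setT (near_kernel r y : leb_rV R n -> \bar R).
    exact: (@measurable_near_kernel r _ _ (cst y) id (measurable_cst _) mid).
  have mtail : measurable_fun setT (tail_kernel r beta y : leb_rV R n -> \bar R).
    exact: (@measurable_tail_kernel r beta _ _ (cst y) id (measurable_cst _) mid).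
  have mGy : measurable_fun setT (fun z : leb_rV R n => G (y, z)).
    exact: (@mG2 _ _ (cst y) id (measurable_cst _) mid).
  have mn : measurable_fun setT (fun z : leb_rV R n => a0%:E * near_kernel r y z)%E.
    exact: measurable_funeM.
  have mt : measurable_fun setT (fun z : leb_rV R n => (K * a1)%:E * tail_kernel r beta y z)%E.
    exact: measurable_funeM.
  have n0' z : (0 <= a0%:E * near_kernel r y z)%E.
    by apply: mule_ge0; [rewrite lee_fin ltW|exact: near_kernel_ge0].
  have Ka1 : 0 <= K * a1 by rewrite mulr_ge0// ltW.
  have t0' z : (0 <= (K * a1)%:E * tail_kernel r beta y z)%E.
    by apply: mule_ge0; [rewrite lee_fin|exact: tail_kernel_ge0].
  apply: (@le_trans _ _ (\int[lebesgue_rV n]_z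
      (a0%:E * near_kernel r y z + (K * a1)%:E * tail_kernel r beta y z + G (y, z)))%E).
    apply: ge0_le_integral_nomeas => z _; last exact: pointwise.
    by rewrite mule_ge0 ?riesz_kernel_ge0 ?lee_fin.
  rewrite integralD_rV; last 4 first.
  - exact: emeasurable_funD.
  - by move=> z; apply: adde_ge0; [exact: n0'|exact: t0'].
  - exact: mGy.
  - by move=> z; exact: G0.
  apply: leeD2r; rewrite integralD_rV//.
  rewrite integralZl_rV; [|exact: mnear|by move=> z; exact: near_kernel_ge0|exact: ltW].
  rewrite integralZl_rV; [|exact: mtail|by move=> z; exact: tail_kernel_ge0|exact: Ka1].
  apply: (@le_trans _ _ (a0%:E * (C1 * r `^ alpha)%:E +
     (K * a1)%:E * (C2 * r `^ (n%:R - beta))%:E)%E).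
    apply: leeD; apply: lee_wpmul2l; rewrite ?lee_fin ?(ltW a00)//.
    by rewrite integral_tail_kernel; exact: tail.
  rewrite -!EFinM -EFinD lee_fin le_eqVlt; apply/orP; left; apply/eqP.
  have r1 : r `^ (- alpha) * r `^ alpha = 1.
    rewrite -powRD; last by rewrite (gt_eqF r0) implybT.
    by rewrite addNr powRr0.
  have r2 : r `^ (theta - alpha) * r `^ (n%:R - beta) = 1.
    rewrite -powRD; last by rewrite (gt_eqF r0) implybT.
    by rewrite (_ : theta - alpha + (n%:R - beta) = 0) ?powRr0// /beta; ring.
  rewrite (_ : _ + _ = c * (C1 * (r `^ (- alpha) * r `^ alpha) +
     K * C2 * (r `^ (theta - alpha) * r `^ (n%:R - beta)))); last by rewrite /a0 /a1; ring.
  rewrite r1 r2 !mulr1 /c; field.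
  by rewrite gt_eqF// addr_gt0// mulr_gt0.
pose A : set (leb_rV R n) := cube x r `&` [set y | (1 <= riesz_potential alpha phi y)%E].
have mA : measurable A.
  apply: measurableI; first exact: measurable_cube_leb.
  have := @measurable_riesz_potential phi mphi phi0 measurableT `[1%E, +oo[%classic.
  rewrite setTI => /(_ (emeasurable_itv _)); congr measurable.
  by apply/seteqP; split=> y /=; rewrite in_itv/= andbT.
pose I : leb_rV R n -> R := \1_(cube x r).
have mI : measurable_fun setT I by apply: measurable_indic; exact: measurable_cube_leb.
(* On [A] the bound [1 <= 1/4 + J] gives [J >= 3/4], more than the 1/2 used here. *)
have half : ((2^-1)%:E * lebesgue_rV n A <= \int[lebesgue_rV n]_y ((I y)%:E * J y))%E.
  have mIA : measurable_fun setT (\1_A : leb_rV R n -> R) by exact: measurable_indic.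
  rewrite -[A in leLHS]setIT -integral_indic; [|exact: measurableT|exact: mA].
  rewrite -integralZl_rV; last 3 first.
  - exact/measurable_EFinP.
  - by move=> y; rewrite lee_fin.
  - by rewrite invr_ge0.
  apply: ge0_le_integral_nomeas => y _; first by rewrite mule_ge0// lee_fin.
  rewrite indicE; case: (boolP (y \in A)) => [/set_mem [xy /= pot]|_]; last first.
    by rewrite mule0 mule_ge0// lee_fin.
  rewrite /I indicE mem_set// mule1 mul1e.
  have := le_trans pot (pot_le y).
  have := J0 y; case: (J y) => [j| |]//; last by move=> _ _; rewrite leey.
  by rewrite -EFinD !lee_fin => j0; lra.
have eqIJ : (\int[lebesgue_rV n]_y ((I y)%:E * J y) =
   \int[lebesgue_rV n]_z \int[lebesgue_rV n]_y ((I y)%:E * G (y, z)))%E.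
  pose F (p : leb_rV R n * leb_rV R n) := ((I p.1)%:E * G p)%E.
  have mF : measurable_fun setT F.
    apply: emeasurable_funM.
      by apply/measurable_EFinP; exact: (measurableT_comp mI measurable_fst).
    have := @mG2 _ _ fst snd measurable_fst measurable_snd.
    by congr measurable_fun; apply/funext => -[].
  have F0 p : (0 <= F p)%E by rewrite mule_ge0 ?lee_fin.
  rewrite -(tonelli_rV mF F0); apply: eq_integral => y _.
  apply/esym; apply: (@integralZl_rV _ _ (I y) (fun z => G (y, z))).
  - exact: (@mG2 _ _ (cst y) id (measurable_cst _) mid).
  - by move=> z; exact: G0.
  - by rewrite /I indicE.
have rs : r `^ (- alpha * (1 - s)) * r `^ alpha = r `^ (alpha * s).
  rewrite -powRD; last by rewrite (gt_eqF r0) implybT.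
  by congr (_ `^ _); ring.
have rs' : r `^ ((theta - alpha) * (1 - s)) * r ^+ n = r `^ (alpha * s).
  rewrite -(powR_mulrn _ (ltW r0)) -powRD; last by rewrite (gt_eqF r0) implybT.
  by rewrite mulrBl thetaE; congr (_ `^ _); ring.
(* For fixed [z] the integral in [y] of the coefficient of [phi z ^ s] is at most
   [b C1 r^alpha + D (2 r)^n]; by [rs] and [rs'] both terms scale like [r^(alpha s)]. *)
have bound : (\int[lebesgue_rV n]_y ((I y)%:E * J y) <=
    (C3 * r `^ (alpha * s))%:E * energy s phi)%E.
  rewrite eqIJ /energy -integralZl_rV; last 3 first.
  - exact: measurable_energy.
  - by move=> y; rewrite lee_fin powR_ge0.
  - by rewrite mulr_ge0 ?powR_ge0 ?(ltW C30).
  apply: ge0_le_integral_nomeas => z _.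
    by apply: integral_ge0 => y _; rewrite mule_ge0 ?lee_fin.
  have mN : measurable_fun setT (fun y : leb_rV R n => near_kernel r y z).
    exact: (@measurable_near_kernel r _ _ id (cst z) mid (measurable_cst _)).
  have mbN : measurable_fun setT (fun y : leb_rV R n => b%:E * near_kernel r y z)%E.
    exact: measurable_funeM.
  have mDI : measurable_fun setT (fun y : leb_rV R n => D%:E * (I y)%:E)%E.
    by apply: measurable_funeM; exact/measurable_EFinP.
  have bN0 y : (0 <= b%:E * near_kernel r y z)%E.
    by apply: mule_ge0; [rewrite lee_fin|exact: near_kernel_ge0].
  have DI0 y : (0 <= D%:E * (I y)%:E)%E by rewrite mule_ge0 ?lee_fin.
  apply: (@le_trans _ _ (\int[lebesgue_rV n]_y
      ((phi z `^ s)%:E * (b%:E * near_kernel r y z + D%:E * (I y)%:E)))%E).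
    apply: ge0_le_integral_nomeas => y _; first by rewrite mule_ge0 ?lee_fin.
    rewrite /G muleA muleC; apply: lee_wpmul2l; first by rewrite lee_fin powR_ge0.
    rewrite /I indicE; case: (y \in _) => /=.
      by rewrite mul1e mule1.
    by rewrite mul0e adde_ge0// mule0.
  rewrite integralZl_rV; last 3 first.
  - exact: emeasurable_funD.
  - by move=> y; apply: adde_ge0.
  - exact: powR_ge0.
  rewrite muleC; apply: lee_wpmul2r; first by rewrite lee_fin powR_ge0.
  rewrite integralD_rV//.
  rewrite integralZl_rV; [|exact: mN|by move=> y; exact: near_kernel_ge0|exact: b0].
  rewrite integralZl_rV; [|exact/measurable_EFinP|by move=> y; rewrite lee_fin|exact: D0].
  rewrite integral_indic; [|exact: measurableT|exact: measurable_cube_leb].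
  rewrite setIT (lebesgue_rV_cube x (ltW r0)).
  apply: (@le_trans _ _ (b%:E * (C1 * r `^ alpha)%:E + D%:E * ((r *+ 2) ^+ n)%:E)%E).
    apply: leeD2r; apply: lee_wpmul2l; first by rewrite lee_fin.
    rewrite (eq_integral (near_kernel r z : leb_rV R n -> \bar R)) => [|y _]; last first.
      by rewrite near_kernelC.
    exact: nearI.
  rewrite -!EFinM -EFinD lee_fin le_eqVlt; apply/orP; left; apply/eqP.
  rewrite /b /D /a0 /a1 /C3 !powRM ?powR_ge0 ?(ltW c0)// -!powRrM.
  rewrite -[r *+ 2]mulr_natl exprMn.
  transitivity (c `^ (1 - s) * (C1 * (r `^ (- alpha * (1 - s)) * r `^ alpha) +
    K * 2 ^+ n * (r `^ ((theta - alpha) * (1 - s)) * r ^+ n))); first by ring.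
  by rewrite rs rs'; ring.
have := le_trans half bound.
move=> /(@lee_wpmul2l _ 2%:E); rewrite lee_fin => /(_ (ler0n _ _)).
rewrite !muleA -!EFinM mulrV ?unitfE ?pnatr_eq0// mul1e => /le_trans; apply.
by rewrite mulrA.
Qed.

End superlevel.

(** * Comparison of Lebesgue measure with capacity *)

Section capacity_measure.
Context {R : realType} {n : nat}.
Variables alpha s : R.
Hypotheses (alpha0 : 0 < alpha) (alphan : alpha < n%:R) (s1 : 1 < s).
Hypothesis alphas : alpha * s < n%:R.
Implicit Types (x y z : 'rV[R]_n) (E : set 'rV[R]_n).
Hypothesis K0 : 0 < (@riesz_const R n alpha)^-1.

Lemma measurable_potential_superlevel (phi : leb_rV R n -> R) (A : set (leb_rV R n)) :
  measurable_fun setT phi -> (forall y, 0 <= phi y) -> measurable A ->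
  measurable (A `&` [set y | (1 <= riesz_potential alpha phi y)%E]).
Proof.
move=> mphi phi0 mA; apply: measurableI => //.
have := @measurable_riesz_potential R n alpha alphan phi mphi phi0 measurableT `[1%E, +oo[%classic.
rewrite setTI => /(_ (emeasurable_itv _)); congr measurable.
by apply/seteqP; split=> y /=; rewrite in_itv/= andbT.
Qed.

(** [E] lies in the superlevel set of the potential of every admissible function, so [|E|] divided
    by the constant is a lower bound for all competing energies. *)
Lemma lebesgue_rV_le_riesz_cap : exists2 C : R, 0 < C &
  forall x r (E : set (leb_rV R n)), 0 < r -> measurable E -> E `<=` cube x r ->
    (lebesgue_rV n E <= (C * r `^ (alpha * s))%:E * riesz_cap alpha s E)%E.
Proof.
have [C C0 h] := riesz_potential_superlevel_le alpha0 alphan s1 alphas K0.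
exists C => // x r E r0 mE Ex; set c := C * _.
have c0 : 0 < c by rewrite mulr_gt0 ?powR_gt0.
rewrite -(@lee_pmul2l _ c^-1%:E) ?lte_fin ?invr_gt0//.
rewrite muleA -EFinM mulVf ?gt_eqF// mul1e riesz_capE//.
apply: le_ereal_inf_tmp => _ [phi [mphi phi0 phiE] <-].
rewrite -(@lee_pmul2l _ c%:E) ?lte_fin// muleA -EFinM mulfV ?gt_eqF// mul1e.
apply: le_trans (h phi x r mphi phi0 r0).
apply: le_measure; rewrite ?inE//.
  by apply: measurable_potential_superlevel => //; exact: measurable_cube_leb.
by move=> y Ey; split; [exact: Ex|exact: phiE].
Qed.

(** [E] is not known to be measurable, so a measurable null cover has to be produced: in each cube,
    the intersection of the superlevel sets of potentials whose energies tend to 0. *)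
Lemma riesz_cap_eq0_negligible E : riesz_cap alpha s E = 0%E ->
  (lebesgue_rV n).-negligible E.
Proof.
move=> E0; have [C C0 h] := riesz_potential_superlevel_le alpha0 alphan s1 alphas K0.
have -> : E = \bigcup_m (E `&` cube 0 m.+1%:R).
  apply/seteqP; split=> [x Ex|x [m _ []]//].
  exists (Num.truncn (\sum_i `|x ord0 i|)) => //; split=> // i; rewrite mxE subr0.
  apply: le_lt_trans (truncnS_gt _).
  by rewrite (bigD1 i)//= lerDl sumr_ge0.
apply: negligible_bigcup => m.
have /choice[phi hphi] k : exists phi, admissible alpha E phi /\
    (energy s phi < k.+1%:R^-1%:E)%E.
  have [|phi ? ?] := @riesz_cap_lt R n alpha s s1 E k.+1%:R^-1%:E.
    by rewrite E0 lte_fin invr_gt0.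
  by exists phi.
pose A k : set (leb_rV R n) :=
  cube 0 m.+1%:R `&` [set y | (1 <= riesz_potential alpha (phi k) y)%E].
have mA k : measurable (A k).
  have [[m1 m2 _] _] := hphi k.
  by apply: measurable_potential_superlevel => //; exact: measurable_cube_leb.
exists (\bigcap_k A k); split.
- exact: bigcapT_measurable.
- apply/eqP; rewrite eq_le measure_ge0 andbT; apply/lee_addgt0Pr => e e0.
  rewrite add0e; pose c := C * m.+1%:R `^ (alpha * s).
  have c0 : 0 < c by rewrite mulr_gt0 ?powR_gt0.
  pose k := Num.truncn (e / c)^-1.
  apply: (@le_trans _ _ (lebesgue_rV n (A k))).
    apply: le_measure; rewrite ?inE//; first exact: bigcapT_measurable.
    exact: bigcap_inf.
  have [[m1 m2 _] ek] := hphi k.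
  apply: le_trans (h (phi k) 0 m.+1%:R m1 m2 (ltr0Sn _ _)) _.
  apply: (@le_trans _ _ (c%:E * k.+1%:R^-1%:E)%E).
    by apply: lee_wpmul2l; [rewrite lee_fin ltW|exact: ltW].
  rewrite -EFinM lee_fin mulrC -ler_pdivlMr//.
  by rewrite invf_ple ?posrE ?divr_gt0// ltW// truncnS_gt.
- by move=> x [Ex xm] k _; split=> //; have [[_ _ +] _] := hphi k; exact.
Qed.

Lemma riesz_cap_ball_gt0 : (0 < riesz_cap alpha s (eucl_ball (0 : 'rV[R]_n) 1))%E.
Proof.
have [C C0 h] := lebesgue_rV_le_riesz_cap.
have := h 0 1 (eucl_ball 0 1) ltr01 (measurable_eucl_ball _ _) (@sub_eucl_ball_cube _ _ _ _).
have : (0 < lebesgue_rV n (eucl_ball (0 : 'rV[R]_n) 1))%E.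
  have c0 : (0 < lebesgue_rV n (cube (0 : 'rV[R]_n) (1 / n.+1%:R)))%E.
    by rewrite lebesgue_rV_cube ?divr_ge0// lte_fin exprn_gt0// mulrn_wgt0 ?divr_gt0.
  apply: lt_le_trans c0 _.
  apply: le_measure; rewrite ?inE; [exact: measurable_cube_leb|exact: measurable_eucl_ball|].
  exact: sub_cube_eucl_ball.
move=> /lt_le_trans /[apply]; rewrite powR1 mulr1.
by rewrite pmule_rgt0 ?lte_fin.
Qed.

End capacity_measure.

(** * Weak-type bound over dyadic cells *)

Section dyadic_cells.
Context {R : realType} {n : nat}.
Implicit Types (x y z : 'rV[R]_n).

(** Cells are taken as fibres of this map, so that those of one generation partition the space by
    construction. *)
Definition dyadic_index k x : 'rV[int]_n :=
  \row_i Num.floor (2 ^+ k * x ord0 i).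

Definition dyadic_cell k (m : 'rV[int]_n) : set (leb_rV R n) :=
  [set y | dyadic_index k y = m].

Definition dyadic_corner k (m : 'rV[int]_n) : 'rV[R]_n :=
  \row_i ((m ord0 i)%:~R / 2 ^+ k).

(** A floor is determined by the integers below it, and [m <= 2^k a] is the same as
    [2 m <= 2^(k+1) a]; hence the finer floor determines the coarser one. *)
Lemma dyadic_indexS k x y :
  dyadic_index k.+1 x = dyadic_index k.+1 y -> dyadic_index k x = dyadic_index k y.
Proof.
have half (a : R) (m : int) :
    (m <= Num.floor (2 ^+ k * a)) = (2 * m <= Num.floor (2 ^+ k.+1 * a)).
  by rewrite !floor_ge_int intrM exprS -mulrA ler_pM2l.
move=> /rowP xy; apply/rowP => i; have := xy i; rewrite !mxE => e.
apply/eqP; rewrite eq_le; apply/andP; split; first by rewrite half -e -half lexx.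
by rewrite half e -half lexx.
Qed.

Lemma dyadic_index_le j k x y : (j <= k)%N ->
  dyadic_index k x = dyadic_index k y -> dyadic_index j x = dyadic_index j y.
Proof.
elim: k => [|k IH]; first by rewrite leqn0 => /eqP ->.
rewrite leq_eqVlt => /orP[/eqP -> //|]; rewrite ltnS => jk /dyadic_indexS.
exact: IH.
Qed.

Lemma measurable_dyadic_cell k m : measurable (dyadic_cell k m).
Proof.
have -> : dyadic_cell k m = \bigcap_(i in [set: 'I_n])
    [set y : leb_rV R n | `[(m ord0 i)%:~R / 2 ^+ k, (m ord0 i + 1)%:~R / 2 ^+ k[%classic
       ((y : 'rV[R]_n) ord0 i)].
  have h0 : 0 < 2 ^+ k :> R by rewrite exprn_gt0.
  have fl (a : R) (p : int) : (Num.floor (2 ^+ k * a) == p) =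
      (p%:~R / 2 ^+ k <= a < (p + 1)%:~R / 2 ^+ k).
    by rewrite floor_eq ler_pdivrMr// ltr_pdivlMr// mulrC.
  apply/seteqP; split=> [y /rowP ym i _|y ym].
    by have := ym i; rewrite !mxE /= in_itv/= -fl => /eqP.
  apply/rowP => i; have := ym i I; rewrite /= in_itv/= -fl => /eqP <-.
  by rewrite mxE.
apply: fin_bigcap_measurable => // i _.
have := @measurable_leb_coord R n i measurableT
  `[(m ord0 i)%:~R / 2 ^+ k, (m ord0 i + 1)%:~R / 2 ^+ k[%classic (measurable_itv _).
by rewrite setTI.
Qed.

Lemma floor_dist_lt (a b : R) (p : int) :
  `|Num.floor a - Num.floor b| <= p -> `|a - b| < p%:~R + 1.
Proof.
have /andP[a1 a2] := floor_itv a; have /andP[b1 b2] := floor_itv b.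
rewrite ler_norml => /andP[p1 p2]; rewrite ltr_norml.
have {}p1 : - p%:~R <= (Num.floor a)%:~R - (Num.floor b)%:~R :> R.
  by rewrite -intrB -mulrNz ler_int.
have {}p2 : (Num.floor a)%:~R - (Num.floor b)%:~R <= p%:~R :> R.
  by rewrite -intrB ler_int.
by rewrite !intrD in a2 b2; apply/andP; split; lra.
Qed.

Lemma dist_lt_floor (a b : R) : `|a - b| < 1 -> `|Num.floor a - Num.floor b| <= 1.
Proof.
have /andP[a1 a2] := floor_itv a; have /andP[b1 b2] := floor_itv b.
rewrite ltr_norml => /andP[p1 p2]; rewrite !intrD in a2 b2.
rewrite ler_norml; apply/andP; split; rewrite -ltzD1 -(ltr_int R) !(intrD, intrB, mulrNz); lra.
Qed.

(** Coordinates differing by less than the side of a cell have indices differing by at most one. The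
    shift [e i - 1] runs over -1, 0, 1, so there are [3^n] neighbours. *)
Lemma cube_sub_dyadic_cells k x r : r <= 2^-1 ^+ k ->
  cube x r `<=` \bigcup_(e in [set: {ffun 'I_n -> 'I_3}])
    dyadic_cell k (\row_i (dyadic_index k x ord0 i + (e i)%:Z - 1)).
Proof.
move=> rk y xy.
have h0 : 0 < 2 ^+ k :> R by rewrite exprn_gt0.
have d i : `|dyadic_index k y ord0 i - dyadic_index k x ord0 i| <= 1.
  rewrite !mxE; apply: dist_lt_floor; rewrite -mulrBr normrM gtr0_norm//.
  by rewrite mulrC -ltr_pdivlMr// div1r (lt_le_trans (xy i))// -exprVn.
pose f i : int := dyadic_index k y ord0 i - dyadic_index k x ord0 i + 1.
have f0 i : 0 <= f i by rewrite /f; have := d i; rewrite ler_norml => /andP[]; lia.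
have f3 i : (`|f i| < 3)%N.
  by have := f0 i; rewrite /f; have := d i; rewrite ler_norml => /andP[]; lia.
exists [ffun i => Ordinal (f3 i)] => //; apply/rowP => i; rewrite [RHS]mxE ffunE/=.
by rewrite gez0_abs// /f; ring.
Qed.

End dyadic_cells.

Lemma ord3_dist (a : int) (k : 'I_3) : `|a + k%:Z - 1 - a| <= 1.
Proof. by case: k => -[|[|[|]]]//= _; lia. Qed.

Section maximal.
Context {R : realType} {n : nat}.
Variables alpha s : R.
Hypotheses (alpha0 : 0 < alpha) (alphan : alpha < n%:R) (s1 : 1 < s).
Hypothesis alphas : alpha * s < n%:R.
Implicit Types (x y z : 'rV[R]_n).
Hypothesis K0 : 0 < (@riesz_const R n alpha)^-1.
Let d := n%:R - alpha * s.
Let d0 : 0 < d. Proof. by rewrite subr_gt0. Qed.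

Section fixed_density.
Variable Phi : leb_rV R n -> \bar R.
Hypotheses (mPhi : measurable_fun setT Phi) (Phi0 : forall y, (0 <= Phi y)%E).
Variable lambda : R.
Hypothesis lambda0 : 0 < lambda.

(** Mass is compared with the power [d] of the side, the scaling of capacity, and not with the
    volume. *)
Definition heavy_cell k (m : 'rV[int]_n) : Prop :=
  ((lambda * (2^-1 ^+ k) `^ d)%:E <
    \int[lebesgue_rV n]_(y in dyadic_cell k m) Phi y)%E.

(** Ancestors are named through points: for [y] in the cell, [dyadic_index j y] indexes its ancestor
    of generation [j]. *)
Definition maximal_cell (p : nat * 'rV[int]_n) : Prop :=
  heavy_cell p.1 p.2 /\ forall j (y : 'rV[R]_n), (j < p.1)%N ->
    dyadic_index p.1 y = p.2 -> ~ heavy_cell j (dyadic_index j y).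

Lemma heavy_cell_nonempty k m : heavy_cell k m -> exists y : 'rV[R]_n, dyadic_index k y = m.
Proof.
move=> hm; apply: contrapT => /forallNP h; move: hm; rewrite /heavy_cell.
have -> : dyadic_cell k m = set0 :> set (leb_rV R n) by apply/seteqP; split=> // y; exact: h.
by rewrite integral_set0 lte_fin ltNge mulr_ge0 ?powR_ge0// ltW.
Qed.

(** Generations start at 0, so among the heavy ancestors there is a coarsest one, whatever the total
    mass. *)
Lemma heavy_cell_maximal k m : heavy_cell k m -> exists j (y : 'rV[R]_n),
  [/\ (j <= k)%N, dyadic_index k y = m & maximal_cell (j, dyadic_index j y)].
Proof.
move=> hm; have [y0 y0m] := heavy_cell_nonempty hm.
pose P j := `[< exists2 y : 'rV[R]_n, dyadic_index k y = m & heavy_cell j (dyadic_index j y) >].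
have exP : exists j, P j.
  by exists k; apply/asboolP; exists y0 => //; rewrite y0m.
case: (ex_minnP exP) => j /asboolP[y ym hj] jmin.
exists j, y; split => //.
  by apply: jmin; apply/asboolP; exists y0 => //; rewrite y0m.
split=> // i y' /= ij y'y hi.
have : P i.
  apply/asboolP; exists y => //.
  by rewrite -(dyadic_index_le (ltnW ij) y'y).
by move=> /jmin; rewrite leqNgt ij.
Qed.

Lemma maximal_cell_disjoint p q y : maximal_cell p -> maximal_cell q ->
  dyadic_cell p.1 p.2 y -> dyadic_cell q.1 q.2 y -> p = q.
Proof.
case: p q => [j m] [k l] [/= hj jmax] [/= hk kmax] yj yk.
have [jk|kj|jk] := ltngtP j k.
- by have := kmax j y jk yk; rewrite yj.
- by have := jmax k y kj yj; rewrite yk.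
- by rewrite -yj -yk jk.
Qed.

(** For a heavy cell the power [d] of the side is below its mass over [lambda], and the masses of
    disjoint cells add up. The partial inverse [pickle_inv] enumerates the pairs with each one
    counted exactly once, and numbers that code no maximal cell contribute 0. *)
Lemma integral_maximal_cells (c : R) : 0 <= c ->
  (\sum_(i <oo) (if pickle_inv i is Some p then
     if `[< maximal_cell p >] then (c * (2^-1 ^+ p.1) `^ d)%:E else 0 else 0)
   <= (c / lambda)%:E * \int[lebesgue_rV n]_y Phi y)%E.
Proof.
move=> c0.
pose B (i : nat) : set (leb_rV R n) := if pickle_inv i is Some p then
  if `[< maximal_cell p >] then dyadic_cell p.1 p.2 else set0 else set0.
have mB i : measurable (B i).
  rewrite /B; case: pickle_inv => [p|]; last exact: measurable0.
  by case: asboolP => _; [exact: measurable_dyadic_cell|exact: measurable0].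
have tB : trivIset setT B.
  apply/trivIsetP => i j _ _; apply: contraNeq => /set0P[y []].
  rewrite /B; have := @pickle_invK (nat * 'rV[int]_n)%type i.
  have := @pickle_invK (nat * 'rV[int]_n)%type j.
  case: (pickle_inv i) => [p|]//; case: (pickle_inv j) => [q|]//=.
  move=> <- <-; case: asboolP => // mp yp; case: asboolP => // mq yq.
  by rewrite (maximal_cell_disjoint mp mq yp yq).
have cl0 : 0 <= c / lambda by rewrite divr_ge0// ltW.
apply: (@le_trans _ _ (\sum_(i <oo)
    ((c / lambda)%:E * \int[lebesgue_rV n]_(y in B i) Phi y))%E).
  apply: lee_nneseries => i _.
    case: pickle_inv => [p|] _//; case: ifP => // _.
    by rewrite lee_fin mulr_ge0 ?powR_ge0.
  rewrite /B; case: pickle_inv => [p|]; last by rewrite integral_set0 mule0.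
  case: asboolP => [[hp _]|_]; last by rewrite integral_set0 mule0.
  have -> : c * (2^-1 ^+ p.1) `^ d = c / lambda * (lambda * (2^-1 ^+ p.1) `^ d).
    by rewrite mulrA divfK// gt_eqF.
  by rewrite EFinM; apply: lee_wpmul2l; [rewrite lee_fin|exact: ltW].
rewrite nneseriesZl => [|i _]; last by apply: integral_ge0 => y _; exact: Phi0.
apply: lee_wpmul2l; first by rewrite lee_fin.
rewrite -ge0_integral_bigcup; last 4 first.
- exact: mB.
- exact: measurable_funTS.
- by move=> y _; exact: Phi0.
- exact: tB.
apply: ge0_subset_integral; last by [].
- exact: bigcupT_measurable.
- exact: measurableT.
- exact: mPhi.
- by move=> y _; exact: Phi0.
Qed.

(** Pigeonhole: were all [3^n] neighbouring cells light, the cube would carry at most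
    [3^n lambda (2 r)^d]. *)
Lemma heavy_cube_heavy_cell x r k : r <= 2^-1 ^+ k -> 2^-1 ^+ k < 2 * r ->
  ((lambda * 3 ^+ n * 2 `^ d * r `^ d)%:E <
     \int[lebesgue_rV n]_(y in cube x r) Phi y)%E ->
  exists2 m : 'rV[int]_n, heavy_cell k m &
    forall i, `|m ord0 i - dyadic_index k x ord0 i| <= 1.
Proof.
move=> rk kr; have r0 : 0 < r.
  by rewrite -(@pmulr_rgt0 _ 2)// (lt_trans _ kr) ?exprn_gt0 ?invr_gt0.
pose m (e : {ffun 'I_n -> 'I_3}) : 'rV[int]_n :=
  \row_i (dyadic_index k x ord0 i + (e i)%:Z - 1).
apply: contraPP => /forall2NP h; apply/negP; rewrite -leNgt.
have hm e : (\int[lebesgue_rV n]_(y in dyadic_cell k (m e)) Phi y <=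
    (lambda * (2^-1 ^+ k) `^ d)%:E)%E.
  rewrite leNgt; apply/negP => he; case: (h (m e)); first exact.
  by apply => i; rewrite /m mxE; exact: ord3_dist.
apply: (@le_trans _ _ (\sum_(e : {ffun 'I_n -> 'I_3})
    \int[lebesgue_rV n]_(y in dyadic_cell k (m e)) Phi y)%E).
  under eq_bigr do rewrite integral_mkcond.
  rewrite -ge0_integral_sum; last 3 first.
  - exact: measurableT.
  - move=> e; apply/(measurable_restrictT _ (measurable_dyadic_cell _ _)).
    exact: measurable_funTS.
  - by move=> e y _; apply: erestrict_ge0.
  rewrite [leLHS]integral_mkcond; apply: ge0_le_integral_nomeas => y _.
    by apply: erestrict_ge0.
  rewrite patchE; case: ifPn => [/set_mem yx|_]; last first.
    by apply: sume_ge0 => e _; apply: erestrict_ge0.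
  have [e _ ye] := cube_sub_dyadic_cells rk yx.
  rewrite (bigD1 e)//= {1}patchE mem_set//= leeDl//.
  by apply: sume_ge0 => e' _; apply: erestrict_ge0.
apply: (@le_trans _ _ (\sum_(e : {ffun 'I_n -> 'I_3}) (lambda * (2^-1 ^+ k) `^ d)%:E)%E).
  by apply: lee_sum => e _; exact: hm.
rewrite sumEFin lee_fin sumr_const card_ffun !card_ord -[leLHS]mulr_natl natrX.
rewrite (_ : lambda * _ * _ * _ = 3 ^+ n * (lambda * (2 * r) `^ d)); last first.
  by rewrite powRM ?(ltW r0)//; ring.
rewrite ler_wpM2l ?exprn_ge0// ler_wpM2l ?(ltW lambda0)//.
by rewrite ge0_ler_powR ?nnegrE ?(ltW d0) ?exprn_ge0 ?invr_ge0 ?mulr_ge0 ?(ltW r0) ?(ltW kr).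
Qed.

End fixed_density.

(* The cubes of density exceeding [lambda] are absorbed by fixed dilates of the
   maximal heavy dyadic cells, which are disjoint. *)
Lemma riesz_cap_maximal_le : exists2 C : R, 0 < C &
  forall (Phi : leb_rV R n -> \bar R) lambda,
    measurable_fun setT Phi -> (forall y, (0 <= Phi y)%E) -> 0 < lambda ->
    (riesz_cap alpha s [set x : 'rV[R]_n | exists r, [/\ (0 < r)%R, (r <= 1)%R &
        (lambda * r `^ d)%:E < \int[lebesgue_rV n]_(y in cube x r) Phi y]]
     <= (C / lambda)%:E * \int[lebesgue_rV n]_y Phi y)%E.
Proof.
have [C0 C00 capC] := riesz_cap_cube_le alphan s1 K0.
pose c := C0 * 3 `^ d; have c0 : 0 < c by rewrite mulr_gt0 ?powR_gt0.
exists (c * (3 ^+ n * 2 `^ d)); first by rewrite !mulr_gt0 ?exprn_gt0 ?powR_gt0.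
move=> Phi lambda mPhi Phi0 lambda0.
pose l := lambda / (3 ^+ n * 2 `^ d).
have l0 : 0 < l by rewrite divr_gt0// mulr_gt0 ?exprn_gt0 ?powR_gt0.
have -> : c * (3 ^+ n * 2 `^ d) / lambda = c / l by rewrite /l invf_div -[LHS]mulrA.
apply: le_trans (integral_maximal_cells mPhi Phi0 l0 (ltW c0)).
(* The dilation 3 is 2 + 1: a point of the heavy cell next to [x] is within [2 * 2^-k <= 2 * 2^-j]
   of [x], and within [2^-j] of the corner of the maximal cell that contains it. *)
pose F i : set 'rV[R]_n := if pickle_inv i is Some p then
  if `[< maximal_cell Phi l p >] then cube (dyadic_corner p.1 p.2) (3 * 2^-1 ^+ p.1)
  else set0 else set0.
apply: (@le_trans _ _ (riesz_cap alpha s (\bigcup_i F i))).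
  apply: le_riesz_cap => // x [r [r0 r1 xr]].
  (* [r <= 1] provides a generation [k >= 0] with [2^-(k+1) < r <= 2^-k]. *)
  have [|k /andP[k1 k2]] := @dyadic_bracket R r^-1; first by rewrite invf_ge1.
  have rk : r <= 2^-1 ^+ k by rewrite exprVn -[r]invrK lef_pV2 ?posrE ?exprn_gt0 ?invr_gt0.
  have kr : 2^-1 ^+ k < 2 * r.
    rewrite exprVn invf_plt ?posrE ?mulr_gt0 ?exprn_gt0// invfM mulrC.
    by rewrite ltr_pdivrMr// -exprSr.
  have [|m hm mx] := @heavy_cube_heavy_cell Phi mPhi Phi0 l l0 x r k rk kr.
    apply: le_lt_trans xr; rewrite lee_fin ler_wpM2r ?powR_ge0//.
    by rewrite /l -mulrA divfK// gt_eqF// mulr_gt0 ?exprn_gt0 ?powR_gt0.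
  have [j [y [jk ym maxj]]] := heavy_cell_maximal l0 hm.
  exists (pickle (j, dyadic_index j y)) => //.
  rewrite /F pickleK_inv asboolT// => i /=.
  have h2 a : 0 < 2 ^+ a :> R by rewrite exprn_gt0.
  have xy : `|x ord0 i - y ord0 i| < 2 * 2^-1 ^+ j.
    apply: (@lt_le_trans _ _ (2 * 2^-1 ^+ k)); last first.
      by rewrite ler_wpM2l// ler_wiXn2l ?invr_ge0// invf_le1// ler1n.
    rewrite exprVn ltr_pdivlMr// mulrC -[X in X * _]gtr0_norm// -normrM mulrBr.
    have := mx i; rewrite -ym !mxE distrC => /(@floor_dist_lt R).
    by rewrite -[2](natrD _ 1 1).
  have yc : `|y ord0 i - (Num.floor (2 ^+ j * y ord0 i))%:~R / 2 ^+ j| <= 2^-1 ^+ j.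
    rewrite exprVn -[leRHS]div1r ler_pdivlMr// -[X in _ * X]gtr0_norm// -normrM.
    rewrite mulrBl divfK ?gt_eqF// mulrC.
    have /andP[f1 f2] := floor_itv (2 ^+ j * y ord0 i).
    by rewrite ger0_norm ?subr_ge0// lerBlDl -[1]/(1%:~R) -intrD ltW.
  rewrite !mxE (le_lt_trans (ler_distD (y ord0 i) _ _))//.
  have -> : 3 * 2^-1 ^+ j = 2 * 2^-1 ^+ j + 2^-1 ^+ j :> R by ring.
  exact: ltr_leD.
apply: le_trans (riesz_cap_sigma_subadditive s1 alphan F) _.
apply: lee_nneseries => i _; first by move=> _; exact: riesz_cap_ge0.
rewrite /F; case: pickle_inv => [p|]; last by rewrite riesz_cap0.
case: asboolP => _; last by rewrite riesz_cap0.
have h0 : 0 < 2^-1 ^+ p.1 :> R by rewrite exprn_gt0 ?invr_gt0.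
apply: le_trans (capC _ _ _) _; first by rewrite mulr_gt0.
by rewrite lee_fin powRM ?(ltW h0)// /c mulrA.
Qed.

End maximal.

(** * Families of sets with small total capacity *)

Section exceptional_set.
Context {R : realType} {n : nat}.
Variables alpha s : R.
Hypotheses (alpha0 : 0 < alpha) (alphan : alpha < n%:R) (s1 : 1 < s).
Hypothesis alphas : alpha * s < n%:R.
Implicit Types (x y z : 'rV[R]_n) (E : set 'rV[R]_n).
Hypothesis K0 : 0 < (@riesz_const R n alpha)^-1.
Let d := n%:R - alpha * s.

Lemma riesz_cap_potential_ge (phi : leb_rV R n -> R) c :
  measurable_fun setT phi -> (forall y, 0 <= phi y) -> 0 < c ->
  (riesz_cap alpha s [set x : 'rV[R]_n | c%:E <= riesz_potential alpha phi x] <=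
   (c^-1 `^ s)%:E * energy s phi)%E.
Proof.
move=> mphi phi0 c0; have c10 : 0 <= c^-1 by rewrite invr_ge0 ltW.
rewrite -(energyZ s mphi phi0 c10); apply: (riesz_cap_le s1); split.
- by apply: measurable_funM; [exact: measurable_cst|exact: mphi].
- by move=> y; rewrite mulr_ge0.
move=> x /= cx; rewrite riesz_potentialZ//.
by rewrite -(@lee_pmul2l _ c%:E)// ?lte_fin// mule1 muleA -EFinM mulfV ?gt_eqF// mul1e.
Qed.

(** Two kinds of points are discarded: [A1], where some potential is too large for localization, and
    [A2], where [Phi] is too dense at some scale. Elsewhere every [E k] is localized and the
    resulting integrals are summed under [Phi]. *)
Lemma riesz_cap_sparse : exists2 C : R, 0 < C &
  forall (E : nat -> set 'rV[R]_n) delta lambda,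
    0 < lambda -> lambda <= 1 ->
    (\sum_(k <oo) riesz_cap alpha s (E k) < delta%:E)%E ->
    exists2 A : set 'rV[R]_n, (riesz_cap alpha s A <= (C * delta / lambda)%:E)%E &
      forall x, ~ A x -> (forall k, ~ E k x) /\
        forall r, 0 < r -> r <= 2^-1 ->
          (\sum_(k <oo) riesz_cap alpha s (E k `&` cube x r) <= (lambda * r `^ d)%:E)%E.
Proof.
pose N : R := n.+1%:R.
(* The threshold of [riesz_cap_localize]. As it is at most 1, each [E k] is contained in [A1]. *)
pose c := 2^-1 * (2 * N) `^ (alpha - n%:R).
have N2 : 0 < 2 * N by rewrite mulr_gt0 ?ltr0n.
have c0 : 0 < c by rewrite mulr_gt0 ?powR_gt0.
have c1 : c <= 1.
  rewrite /c -[alpha - n%:R]opprB powRN mulr_ile1 ?invr_ge0 ?powR_ge0//.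
    by rewrite invf_le1// ler1n.
  have N1 : 1 <= 2 * N by rewrite -natrM ler1n.
  have : (2 * N) `^ 0 <= (2 * N) `^ (n%:R - alpha).
    by apply: ler_powR; rewrite ?subr_ge0 ?(ltW alphan).
  by rewrite powRr0 invf_le1// powR_gt0.
have [C1 C10 maxC] := riesz_cap_maximal_le alphan s1 alphas K0.
(* [2^s] comes from localization and [2^d] from the doubled cube; testing [Phi] at density
   [lambda / M] absorbs both. The restriction [r <= 2^-1] keeps [2 r] in the range of the maximal
   bound. *)
pose M := 2 `^ s * 2 `^ d; have M0 : 0 < M by rewrite mulr_gt0 ?powR_gt0.
exists (c^-1 `^ s + C1 * M); first by rewrite addr_gt0 ?mulr_gt0 ?powR_gt0 ?invr_gt0.
move=> E delta lambda lambda0 lambda1 /(riesz_cap_seq_lt s1)[phi [aphi ephi]].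
have sum0 : (0 <= \sum_(k <oo) energy s (phi k))%E.
  by apply: nneseries_ge0 => k _ _; exact: energy_ge0.
have delta0 : 0 <= delta by rewrite -lee_fin (le_trans sum0)// ltW.
pose Phi (y : leb_rV R n) := (\sum_(k <oo) (phi k y `^ s)%:E)%E.
have mphi k : measurable_fun setT (phi k) by case: (aphi k).
have phi0 k y : 0 <= phi k y by case: (aphi k).
have me k : measurable_fun setT (fun y : leb_rV R n => (phi k y `^ s)%:E).
  exact: measurable_energy.
have e0 k (y : leb_rV R n) : (0 <= (phi k y `^ s)%:E)%E by rewrite lee_fin powR_ge0.
have mPhi : measurable_fun setT Phi.
  by apply: ge0_emeasurable_sum => [k y _ _|k _]; [exact: e0|exact: me].
have Phi0 y : (0 <= Phi y)%E by apply: nneseries_ge0.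
have int_Phi : (\int[lebesgue_rV n]_y Phi y = \sum_(k <oo) energy s (phi k))%E.
  exact: integral_series_rV.
pose l := lambda / M; have l0 : 0 < l by rewrite divr_gt0.
pose A1 := \bigcup_k [set x : 'rV[R]_n | (c%:E <= riesz_potential alpha (phi k) x)%E].
pose A2 := [set x : 'rV[R]_n | exists r, [/\ (0 < r)%R, (r <= 1)%R &
  ((l * r `^ d)%:E < \int[lebesgue_rV n]_(y in cube x r) Phi y)%E]].
have capA1 : (riesz_cap alpha s A1 <= (c^-1 `^ s * delta)%:E)%E.
  apply: le_trans (riesz_cap_sigma_subadditive s1 alphan _) _.
  apply: (@le_trans _ _ (\sum_(k <oo) (c^-1 `^ s)%:E * energy s (phi k))%E).
    apply: lee_nneseries => k _; first by move=> _; exact: riesz_cap_ge0.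
    exact: riesz_cap_potential_ge.
  rewrite nneseriesZl => [|k _]; last exact: energy_ge0.
  by rewrite EFinM; apply: lee_wpmul2l; [rewrite lee_fin powR_ge0|exact: ltW].
have capA2 : (riesz_cap alpha s A2 <= (C1 / l * delta)%:E)%E.
  apply: le_trans (maxC Phi l mPhi Phi0 l0) _.
  rewrite [leRHS]EFinM; apply: lee_wpmul2l; first by rewrite lee_fin divr_ge0// ltW.
  by rewrite int_Phi ltW.
exists (A1 `|` A2).
  apply: le_trans (riesz_capU s1 alphan _ _) _.
  apply: le_trans (leeD capA1 capA2) _; rewrite -EFinD lee_fin.
  rewrite /l invf_div mulrDl mulrDl mulrA.
  apply: lerD; last by rewrite le_eqVlt; apply/orP; left; apply/eqP; ring.
  (* The bound for [A1] carries no [lambda]; [lambda <= 1] brings it under the common form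
     [delta / lambda]. *)
  by rewrite ler_pdivlMr// ler_piMr// mulr_ge0 ?powR_ge0.
move=> x /not_orP[xA1 xA2].
have small k : (riesz_potential alpha (phi k) x < c%:E)%E.
  by rewrite ltNge; apply/negP => h; apply: xA1; exists k.
split=> [k Ekx|r r0 r2].
  have := small k; rewrite ltNge => /negP; apply.
  by case: (aphi k) => _ _ /(_ x Ekx); apply: le_trans; rewrite lee_fin.
apply: (@le_trans _ _ (\sum_(k <oo)
    (2 `^ s)%:E * \int[lebesgue_rV n]_(y in cube x (2 * r)) (phi k y `^ s)%:E)%E).
  apply: lee_nneseries => k _; first by move=> _; exact: riesz_cap_ge0.
  by apply: riesz_cap_localize => //; exact: small.
rewrite nneseriesZl => [|k _]; last by apply: integral_ge0 => y _; exact: e0.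
have -> : (\sum_(k <oo) \int[lebesgue_rV n]_(y in cube x (2 * r)) (phi k y `^ s)%:E =
    \int[lebesgue_rV n]_(y in cube x (2 * r)) Phi y)%E.
  rewrite /Phi integral_nneseries; [by []|exact: measurable_cube_leb| |].
    by move=> k; apply: measurable_funTS; exact: me.
  by move=> k y _; exact: e0.
have le2 : (\int[lebesgue_rV n]_(y in cube x (2 * r)) Phi y <= (l * (2 * r) `^ d)%:E)%E.
  rewrite leNgt; apply/negP => h; apply: xA2; exists (2 * r); split=> //.
    by rewrite mulr_gt0.
  by rewrite mulrC -ler_pdivlMr// div1r.
apply: (@le_trans _ _ ((2 `^ s)%:E * (l * (2 * r) `^ d)%:E)%E).
  by apply: lee_wpmul2l; first by rewrite lee_fin powR_ge0.
rewrite -EFinM lee_fin powRM ?(ltW r0)// le_eqVlt; apply/orP; left; apply/eqP.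
by rewrite /l /M; field; rewrite !gt_eqF ?powR_gt0.
Qed.

End exceptional_set.

(** * Choquet integrals and oscillation *)

Section step_integrals.
Context {R : realType}.
Implicit Types (h : R -> \bar R) (u : nat -> \bar R) (f : nat -> \bar R).

Lemma nneseries_recl_shift f : (forall k, 0 <= f k)%E ->
  (\sum_(k <oo) f k = f 0%N + \sum_(k <oo) f k.+1)%E.
Proof.
move=> f0; rewrite nneseries_recl//; congr (_ + _)%E.
by rewrite -nneseries_addn//; apply: eq_eseriesr => k _; rewrite addn1.
Qed.

Let integral_step (a b : R) (u : \bar R) : (0 <= u)%E -> a <= b ->
  (\int[lebesgue_measure]_t (u * (\1_(`[a, b[%classic) t)%:E) = u * (b - a)%:E)%E.
Proof.
move=> u0 ab; rewrite ge0_integralZl//; last first.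
  exact/measurable_EFinP/measurable_indic.
rewrite integral_indic//= setIT lebesgue_measure_itv/= lte_fin EFinN.
by case: ltgtP ab => // -> _; rewrite subrr.
Qed.

(** A lower Riemann sum: a nonincreasing function is smallest at the right end of each step, whence
    the index [k.+1]. *)
Lemma integral_steps_ge h eta : 0 < eta ->
  (forall t, 0 <= t -> (0 <= h t)%E) ->
  (forall t t', 0 <= t -> t <= t' -> (h t' <= h t)%E) ->
  (\sum_(k <oo) h (eta * k.+1%:R)%R * eta%:E <=
   \int[lebesgue_measure]_(t in `[0%R, +oo[) h t)%E.
Proof.
move=> eta0 h0 hdec.
pose F k t := (h (eta * k.+1%:R)%R *
  (\1_(`[eta * k%:R, eta * k.+1%:R[%classic) t)%:E)%E.
have hk k : (0 <= h (eta * k.+1%:R)%R)%E by rewrite h0// mulr_ge0// ltW.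
have F0 k t : (0 <= F k t)%E by rewrite mule_ge0// lee_fin.
have -> : (\sum_(k <oo) h (eta * k.+1%:R)%R * eta%:E =
    \int[lebesgue_measure]_t (\sum_(k <oo) F k t))%E.
  rewrite integral_nneseries//; last first.
    by move=> k; apply: measurable_funeM; exact/measurable_EFinP/measurable_indic.
  apply: eq_eseriesr => k _; rewrite integral_step//.
    by rewrite -mulrBr -natrB// subSnn mulr1.
  by rewrite ler_pM2l// ler_nat.
rewrite [leRHS]integral_mkcond; apply: ge0_le_integral_nomeas => t _.
  exact: nneseries_ge0.
rewrite patchE; case: ifPn => [|t0].
  rewrite inE/= in_itv/= andbT => t0; pose k := Num.truncn (t / eta).
  have te0 : 0 <= t / eta by rewrite divr_ge0// ltW.
  rewrite (@nneseriesD1 _ _ k xpredT)//= eseries0 => [|i _ ik]; last first.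
    rewrite /F indicE memNset ?mule0//= in_itv/= => /andP[i1 i2].
    move/eqP: ik; apply; apply/esym/truncn_def.
    by rewrite ler_pdivlMr// mulrC i1 ltr_pdivrMr// mulrC.
  rewrite adde0 /F -[leRHS]mule1; apply: lee_pmul => //.
    apply: hdec => //; rewrite mulrC -ler_pdivrMr// ltW//.
    exact: truncnS_gt.
  by rewrite lee_fin indicE lern1; case: (_ \in _).
rewrite eseries0// => i _ _; rewrite /F indicE memNset ?mule0//=.
rewrite in_itv/= => /andP[it _]; move: t0; rewrite notin_setE/= in_itv/= andbT.
by apply; apply: le_trans it; rewrite mulr_ge0// ltW.
Qed.

(** The intervals may overlap, which only enlarges the sum; this permits bands of very different
    lengths. *)
Lemma integral_steps_le h (a b : nat -> R) u :
  (forall t, 0 <= t -> (0 <= h t)%E) -> (forall k, 0 <= u k)%E ->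
  (forall k, a k <= b k) ->
  (forall t, 0 <= t -> exists k, a k <= t < b k /\ (h t <= u k)%E) ->
  (\int[lebesgue_measure]_(t in `[0%R, +oo[) h t <=
   \sum_(k <oo) u k * (b k - a k)%:E)%E.
Proof.
move=> h0 u0 ab cov.
pose F k t := (u k * (\1_(`[a k, b k[%classic) t)%:E)%E.
have F0 k t : (0 <= F k t)%E by rewrite mule_ge0// lee_fin.
have -> : (\sum_(k <oo) u k * (b k - a k)%:E =
    \int[lebesgue_measure]_t (\sum_(k <oo) F k t))%E.
  rewrite integral_nneseries//; last first.
    by move=> k; apply: measurable_funeM; exact/measurable_EFinP/measurable_indic.
  by apply: eq_eseriesr => k _; rewrite integral_step.
rewrite integral_mkcond; apply: ge0_le_integral_nomeas => t _.
  by apply: erestrict_ge0 => t'; rewrite /= in_itv/= andbT; exact: h0.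
rewrite patchE; case: ifPn => [|_]; last exact: nneseries_ge0.
rewrite inE/= in_itv/= andbT => /cov[k [kt hu]]; apply: le_trans hu _.
apply: le_trans (@le_nneseries_term _ (F ^~ t) k _) => //.
by rewrite /F indicE mem_set ?mule1//= in_itv.
Qed.

Lemma eseries_tail_small f (e : R) : (forall k, 0 <= f k)%E ->
  (\sum_(k <oo) f k < +oo)%E -> 0 < e ->
  exists K, (\sum_(k <oo) f (k + K)%N < e%:E)%E.
Proof.
move=> f0 foo e0.
have /fine_cvgP[tfin /cvgrPdist_lt/(_ e e0) tsmall] := nneseries_tail_cvg foo (fun k _ => f0 k).
near \oo => K; exists K; rewrite nneseries_addn//.
have tK : (\sum_(K <= k <oo) f k)%E \is a fin_num by near: K; exact: tfin.
rewrite -(fineK tK) lte_fin.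
have : `|0 - fine (\sum_(K <= k <oo) f k)| < e by near: K; exact: tsmall.
rewrite sub0r normrN; apply: le_lt_trans; exact: ler_norm.
Unshelve. all: by end_near.
Qed.

End step_integrals.

(** * Capacitary oscillation at quasi every point *)

Section oscillation.
Context {R : realType} {n : nat}.
Variables alpha s p : R.
Hypotheses (alpha0 : 0 < alpha) (alphan : alpha < n%:R) (s1 : 1 < s).
Hypotheses (alphas : alpha * s < n%:R) (p1 : 1 <= p).
Implicit Types (x y z : 'rV[R]_n) (E : set 'rV[R]_n).
Hypothesis K0 : 0 < (@riesz_const R n alpha)^-1.
Let d := n%:R - alpha * s.
Let cap := @riesz_cap R n alpha s.
Let p0 : 0 < p. Proof. exact: lt_le_trans p1. Qed.

Lemma choquet_ge0 (A : set 'rV[R]_n) (g : 'rV[R]_n -> \bar R) :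
  (0 <= choquet alpha s A g)%E.
Proof. by apply: integral_ge0 => t _; exact: riesz_cap_ge0. Qed.

Lemma le_choquet_superlevels (A : set 'rV[R]_n) (g : 'rV[R]_n -> R) eta : 0 < eta ->
  (\sum_(k <oo) cap [set y | A y /\ (eta * k.+1%:R < g y)%R] * eta%:E <=
   choquet alpha s A (EFin \o g))%E.
Proof.
move=> eta0.
pose h (t : R) := cap [set y | A y /\ (t < g y)%R].
have -> : choquet alpha s A (EFin \o g) =
    (\int[lebesgue_measure]_(t in `[0%R, +oo[) h t)%E.
  by apply: eq_integral => t _; congr (riesz_cap _ _ _);
    apply/seteqP; split=> y /= [Ay]; rewrite lte_fin.
apply: (@integral_steps_ge R h eta eta0) => [t _|t t' _ tt']; first exact: riesz_cap_ge0.
by apply: le_riesz_cap => // y /= [Ay ty]; split=> //; exact: le_lt_trans ty.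
Qed.

(** Borel-Cantelli for capacity, resting on countable subadditivity alone. *)
Lemma riesz_cap_limsup (E : nat -> set 'rV[R]_n) (C : R) : 0 <= C ->
  (forall j, (cap (E j) <= (C * 2^-1 ^+ j)%:E)%E) ->
  cap (\bigcap_m \bigcup_j E (m + j)%N) = 0%E.
Proof.
move=> C0 capE; apply/eqP; rewrite eq_le riesz_cap_ge0// andbT.
apply/lee_addgt0Pr => e e0; rewrite add0e.
(* [2 C / e < m + 1 <= 2^m], so the tail [\sum_j C 2^-(m+j) = 2 C 2^-m] is at most [e]. *)
pose m := Num.truncn (2 * C / e).
have h2 k : 0 < 2 ^+ k :> R by rewrite exprn_gt0.
apply: (@le_trans _ _ (cap (\bigcup_j E (m + j)%N))).
  by apply: le_riesz_cap => //; exact: bigcap_inf.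
apply: le_trans (riesz_cap_sigma_subadditive s1 alphan _) _.
apply: (@le_trans _ _ (\sum_(j <oo) (2 * C * 2^-1 ^+ m / (2 ^ j.+1)%:R)%:E)%E).
  apply: lee_nneseries => j _; first by move=> _; exact: riesz_cap_ge0.
  apply: le_trans (capE _) _; rewrite lee_fin natrX !exprVn exprD exprS.
  rewrite le_eqVlt; apply/orP; left; apply/eqP.
  by field; rewrite !gt_eqF.
apply: le_trans (epsilon_trick0 _ _) _.
  by rewrite !mulr_ge0 ?exprn_ge0 ?invr_ge0.
rewrite lee_fin exprVn ler_pdivrMr//.
have := truncnS_gt (2 * C / e); rewrite -/m ltr_pdivrMr// => /ltW/le_trans; apply.
by rewrite mulrC ler_pM2l// -natrX ler_nat ltn_expl.
Qed.

Variables (D : set 'rV[R]_n) (f : 'rV[R]_n -> R).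

Let G k : set 'rV[R]_n := [set y | D y /\ k%:R < `|f y| `^ p].

(** Oscillation is measured against [f x], meaningful as [x] is in [D]; the identification of [f x]
    with the limit of averages is deduced from it. *)
Definition small_oscillation x : Prop := D x /\
  forall e : R, 0 < e -> exists2 rho : R, 0 < rho & forall r, 0 < r -> r < rho ->
    (choquet alpha s (eucl_ball x r `&` D) (fun y => (`|f y - f x| `^ p)%:E)
     <= (e * r `^ d)%:E)%E.

(** If both [|f x|^p] and [|f y|^p] were at most [k], then [|f y - f x|] would be at most twice the
    larger modulus; this is the source of [2^p]. *)
Lemma superlevel_oscillation_sub x y k : `|f x| `^ p <= k%:R ->
  2 `^ p * k%:R < `|f y - f x| `^ p -> k%:R < `|f y| `^ p.
Proof.
move=> xk; apply: contraTT; rewrite -!leNgt => yk.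
pose a := Num.max `|f y| `|f x|.
have a0 : 0 <= a by rewrite le_max normr_ge0.
have ak : a `^ p <= k%:R by rewrite /a; case: (leP `|f y| `|f x|).
apply: (@le_trans _ _ ((2 * a) `^ p)).
  rewrite ge0_ler_powR ?nnegrE ?(ltW p0)// ?mulr_ge0//.
  apply: le_trans (ler_normB _ _) _.
  by rewrite mulr_natl mulr2n lerD// /a le_max lexx ?orbT.
by rewrite powRM// ler_wpM2l// powR_ge0.
Qed.

Lemma small_oscillation_ae : Lp_cap alpha s p D f ->
  cap_ae alpha s small_oscillation.
Proof.
move=> [[[N0 capN0 N0D] qc] Lpf].
(* The lower sum of mesh 1 of the Choquet integral of [|f|^p]. *)
have Gsum : (\sum_(k <oo) cap (G k.+1) < +oo)%E.
  have := @le_choquet_superlevels D (fun y => `|f y| `^ p) 1 ltr01.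
  under eq_eseriesr => k _.
    rewrite mule1 (_ : [set y | _] = G k.+1); last by rewrite /G; under eq_fun do rewrite mul1r.
    over.
  move=> /le_lt_trans; apply; apply: lty_poweRy Lpf.
  by rewrite invr_eq0 gt_eqF.
have G0 k : (0 <= cap (G k.+1))%E by exact: riesz_cap_ge0.
have q0 j : 0 < 4^-1 ^+ j / 2 :> R by rewrite divr_gt0 ?exprn_gt0 ?invr_gt0.
have /choice[K capK] j := eseries_tail_small G0 Gsum (q0 j).
have /choice[U HU] j := qc _ (q0 j).
(* Slot 0 holds the exceptional open set, the other slots the integer levels above [K j]; each group
   spends one half of [4^-j]. *)
pose E j k := if k is k'.+1 then G (k' + K j).+1 else U j.
have Esum j : (\sum_(k <oo) cap (E j k) < (4^-1 ^+ j)%:E)%E.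
  rewrite nneseries_recl_shift => [|k]; last exact: riesz_cap_ge0.
  have [_ Oj _] := HU j.
  by rewrite [4^-1 ^+ j]splitr EFinD; apply: lteD; [exact: Oj|exact: capK].
have [C C0 sparse] := riesz_cap_sparse alphan s1 alphas K0.
have h01 j : 0 < 2^-1 ^+ j :> R by rewrite exprn_gt0 ?invr_gt0.
have h1 j : 2^-1 ^+ j <= 1 :> R by rewrite exprn_ile1 ?invr_ge0// invf_le1// ler1n.
have /choice[N HN] j : exists A : set 'rV[R]_n, (cap A <= (C * 2^-1 ^+ j)%:E)%E /\
    forall x, ~ A x -> (forall k, ~ E j k x) /\ forall r, 0 < r -> r <= 2^-1 ->
      (\sum_(k <oo) cap (E j k `&` cube x r) <= (2^-1 ^+ j * r `^ d)%:E)%E.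
  have [A capA HA] := sparse (E j) _ _ (h01 j) (h1 j) (Esum j).
  exists A; split=> //; apply: le_trans capA _; rewrite lee_fin.
  have -> : 4^-1 ^+ j = 2^-1 ^+ j * 2^-1 ^+ j :> R.
    by rewrite -exprMn -invfM -natrM.
  by rewrite mulrA mulfK// gt_eqF.
exists (N0 `|` \bigcap_m \bigcup_j N (m + j)%N).
  apply/eqP; rewrite eq_le riesz_cap_ge0// andbT.
  apply: le_trans (riesz_capU s1 alphan _ _) _.
  have := @riesz_cap_limsup N C (ltW C0) (fun j => (HN j).1); rewrite /cap => ->.
  by rewrite capN0 adde0.
move=> x /not_orP[xN0 xN]; have Dx := N0D x xN0.
have [m xm] : exists m, forall j, ~ N (m + j)%N x.
  apply: contrapT => /forallNP h; apply: xN => m _.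
  have /existsNP[j /contrapT Nj] := h m; by exists j.
split=> // e e0.
have [C1 C10 capC] := riesz_cap_cube_le alphan s1 K0.
pose L := 2 `^ p; have L0 : 0 < L by rewrite powR_gt0.
have pow_small (c : R) : 0 < c -> exists j, 2^-1 ^+ (m + j) * c <= e / 3.
  move=> c0; exists (Num.truncn (3 * c / e)); set j := Num.truncn _.
  have h2 : 0 < 2 ^+ (m + j) :> R by rewrite exprn_gt0.
  have u : j.+1%:R <= 2 ^+ (m + j) :> R.
    rewrite -natrX ler_nat; apply: leq_trans (ltn_expl j (ltnSn 1)) _.
    by rewrite leq_exp2l// leq_addl.
  have := truncnS_gt (3 * c / e); rewrite -/j ltr_pdivrMr// => t.
  rewrite exprVn mulrC ler_pdivrMr//.
  by have := ler_wpM2r (ltW e0) u; lra.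
(* Two indices are chosen in succession. [i1] handles the high levels and fixes, through [K i1] and
   [f x], where they begin; the band below them has height [L * k0], which depends on [i1], so a
   second index [i2] is needed to make it small. *)
have [j1 hj1] := pow_small L L0; set i1 := (m + j1)%N in hj1.
pose k0 := ((K i1).+1 + (Num.truncn (`|f x| `^ p)).+1)%N.
have xk0 k : (k0 <= k)%N -> `|f x| `^ p <= k%:R.
  move=> kk; apply: le_trans (ltW (truncnS_gt _)) _.
  by rewrite ler_nat (leq_trans _ kk)// leq_addl.
have k00 : 0 < L * k0%:R by rewrite mulr_gt0// ltr0n.
have [j2 hj2] := pow_small (L * k0%:R) k00; set i2 := (m + j2)%N in hj2.
(* The lowest band has height [eta] and capacity at most [C1 r^d], hence costs a third of [e]; [hj2]
   and [hj1] provide the other two thirds. *)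
pose eta := e / 3 / C1; have eta0 : 0 < eta by rewrite !divr_gt0.
have [oO _ fO] := HU i2.
have [xE1 sp1] := (HN i1).2 x (xm j1).
have [xE2 sp2] := (HN i2).2 x (xm j2).
have xO : ~ U i2 x by exact: (xE2 0%N).
pose eta' := eta `^ p^-1; have eta'0 : 0 < eta' by rewrite powR_gt0.
have [rho rho0 frho] : exists2 rho : R, 0 < rho &
    forall y, D y -> ~ U i2 y -> cube x rho y -> `|f y - f x| < eta'.
  have xS : (D `\` U i2) x by split.
  have := (subspace_continuousP _ _).1 fO x xS => /cvgrPdist_lt/(_ _ eta'0).
  move=> /nbhs_ballP[rho/= rho0 hrho].
  exists rho => // y Dy Oy xy; rewrite distrC; apply: hrho; last by split.
  by split=> // a i; rewrite (ord1 a) /ball/= distrC; exact: xy.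
exists (Num.min rho 2^-1); first by rewrite lt_min rho0 invr_gt0/=.
move=> r r0; rewrite lt_min => /andP[rrho r2]; have {}r2 := ltW r2.
have ballr y : eucl_ball x r y -> cube x r y by exact: sub_eucl_ball_cube.
(* Levels below [eta] are met in the whole cube, levels between [eta] and [L * k0]
   only in [U i2], higher ones only where [|f|] is itself large. *)
pose u k := if k is k'.+1 then
    if k' is k''.+1 then cap (E i1 k''.+1 `&` cube x r)
    else cap (U i2 `&` cube x r)
  else cap (cube x r).
pose a k : R := if k is k'.+2 then L * (k' + K i1).+1%:R else 0.
pose b k : R := if k is k'.+1 then
    if k' is k''.+1 then L * (k'' + K i1).+2%:R else L * k0%:R
  else eta.
have u0 k : (0 <= u k)%E by case: k => [|[|k]]; exact: riesz_cap_ge0.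
have ab k : a k <= b k.
  by case: k => [|[|k]]/=; rewrite ?(ltW eta0) ?(ltW k00)// ler_pM2l// ler_nat.
pose h (t : R) := cap [set y | (eucl_ball x r `&` D) y /\ (t%:E < (`|f y - f x| `^ p)%:E)%E].
have -> : choquet alpha s (eucl_ball x r `&` D) (fun y => (`|f y - f x| `^ p)%:E) =
  (\int[lebesgue_measure]_(t in `[0%R, +oo[) h t)%E by [].
apply: (@le_trans _ _ (\sum_(k <oo) u k * (b k - a k)%:E)%E).
  apply: integral_steps_le => //.
    by move=> t _; exact: riesz_cap_ge0.
  move=> t t0; have [teta|etat] := ltP t eta.
    exists 0%N; split; first by rewrite /= t0.
    by apply: le_riesz_cap => // y [[/ballr]].
  have [tk|kt] := ltP t (L * k0%:R).
    exists 1%N; split; first by rewrite /= t0.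
    apply: le_riesz_cap => // y [[/ballr xy Dy]]; rewrite lte_fin => ty; split=> //.
    apply: contrapT => Oy.
    have := frho y Dy Oy (sub_cube (ltW rrho) xy).
    move=> /ltW/(ge0_ler_powR (ltW p0)); rewrite !nnegrE powR_ge0 normr_ge0 => /(_ isT isT).
    rewrite -powRrM mulVf ?gt_eqF// powRr1 ?(ltW eta0)// leNgt.
    by move/negP; apply; exact: le_lt_trans ty.
  pose k := Num.truncn (t / L).
  have /andP[k1 k2] : k%:R <= t / L < k.+1%:R by apply: truncn_itv; rewrite divr_ge0// ltW.
  have kk0 : (k0 <= k)%N by rewrite truncn_ge_nat ?divr_ge0 ?(ltW L0)// ler_pdivlMr// mulrC.
  (* As [k >= k0 > K i1], level [k] is stored in [E i1], at slot [(k - (K i1).+1).+1]; the sequence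
     [u] has one more term in front. *)
  have kK : ((k - (K i1).+1) + K i1).+1 = k.
    by rewrite -addnS subnK// (leq_trans _ kk0)// leq_addr.
  exists (k - (K i1).+1).+2; split.
    by rewrite /= kK mulrC -ler_pdivlMr// k1 mulrC -ltr_pdivrMr.
  apply: le_riesz_cap => // y [[/ballr xy Dy]]; rewrite lte_fin => ty; split=> //.
  rewrite /E kK; split=> //; apply: (superlevel_oscillation_sub (xk0 _ kk0)).
  by apply: le_lt_trans ty; rewrite mulrC -ler_pdivlMr.
have uab0 k : (0 <= u k * (b k - a k)%:E)%E by rewrite mule_ge0// lee_fin subr_ge0.
rewrite nneseries_recl_shift// nneseries_recl_shift => [/=|k]; last exact: uab0.
have -> : e * r `^ d = C1 * r `^ d * eta + (e / 3 * r `^ d + e / 3 * r `^ d).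
  by rewrite /eta; field; rewrite gt_eqF.
rewrite !subr0 [leRHS]EFinD [X in (_ <= _ + X)%E]EFinD.
apply: leeD; last apply: leeD.
- rewrite [leRHS]EFinM; apply: lee_wpmul2r; first by rewrite lee_fin ltW.
  exact: capC.
- apply: (@le_trans _ _ ((2^-1 ^+ i2 * r `^ d)%:E * (L * k0%:R)%:E)%E).
    apply: lee_wpmul2r; first by rewrite lee_fin ltW.
    apply: le_trans (sp2 r r0 r2).
    apply: (@le_nneseries_term _ (fun k => cap (E i2 k `&` cube x r)) 0%N) => i.
    exact: riesz_cap_ge0.
  by rewrite -EFinM lee_fin mulrAC ler_wpM2r ?powR_ge0.
apply: (@le_trans _ _ (L%:E * \sum_(k <oo) cap (E i1 k.+1 `&` cube x r))%E).
  rewrite -nneseriesZl => [|k _]; last exact: riesz_cap_ge0.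
  apply: lee_nneseries => k _.
    by move=> _; exact: (uab0 k.+2).
  rewrite -mulrBr -natrB// subSnn mulr1 muleC.
  by apply: lee_wpmul2l; rewrite ?lee_fin ?(ltW L0).
apply: (@le_trans _ _ (L%:E * (2^-1 ^+ i1 * r `^ d)%:E)%E).
  apply: lee_wpmul2l; first by rewrite lee_fin ltW.
  apply: le_trans (sp1 r r0 r2).
  rewrite [leRHS]nneseries_recl_shift => [|k]; last exact: riesz_cap_ge0.
  by rewrite leeDr//; exact: riesz_cap_ge0.
by rewrite -EFinM lee_fin mulrCA mulrA ler_wpM2r ?powR_ge0.
Qed.

End oscillation.

(** * Lebesgue points *)

Section lebesgue_points.
Context {R : realType} {n : nat}.
Variables alpha s : R.
Hypotheses (alpha0 : 0 < alpha) (alphan : alpha < n%:R) (s1 : 1 < s).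
Hypotheses (alphas : alpha * s < n%:R).
Implicit Types (x y z : 'rV[R]_n) (E : set 'rV[R]_n).
Hypothesis K0 : 0 < (@riesz_const R n alpha)^-1.
Let d := n%:R - alpha * s.

(** [f] is continuous on each [D \ U j], and what these sets miss lies in the intersection of the
    [U j]. That set has zero capacity, so it is null, and completeness of the measure makes any
    function measurable on it. *)
Lemma quasicontinuous_measurable (D : set (leb_rV R n)) (f : leb_rV R n -> R) :
  quasicontinuous alpha s D f -> measurable D /\ measurable_fun D f.
Proof.
move=> [[N capN ND] qc].
have null_meas (A : set (leb_rV R n)) : (lebesgue_rV n).-negligible A -> measurable A.
  exact: lebesgue_rV_complete.
have cap_null (A : set (leb_rV R n)) : riesz_cap alpha s A = 0%E ->
    (lebesgue_rV n).-negligible A.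
  exact: riesz_cap_eq0_negligible.
have mD : measurable D.
  rewrite -[D]setCK; apply: measurableC; apply: null_meas.
  apply: (negligibleS _ (cap_null N capN)) => x Dx.
  by apply: contrapT => /ND.
split=> //.
have e0 j : 0 < j.+1%:R^-1 :> R by rewrite invr_gt0.
have /choice[U HU] j := qc _ (e0 j).
pose A := \bigcap_j U j.
have nA : (lebesgue_rV n).-negligible (A : set (leb_rV R n)).
  apply: cap_null; apply/eqP; rewrite eq_le riesz_cap_ge0// andbT.
  apply/lee_addgt0Pr => e e1; rewrite add0e.
  pose j := Num.truncn e^-1; have [_ /ltW capU _] := HU j.
  apply: (@le_trans _ _ (riesz_cap alpha s (U j))).
    by apply: le_riesz_cap => //; exact: bigcap_inf.
  apply: le_trans capU _; rewrite lee_fin invf_ple ?posrE//.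
  exact/ltW/truncnS_gt.
have mU j : measurable (U j : set (leb_rV R n)).
  by apply: measurable_borel_leb; apply: open_measurable_rV; case: (HU j).
have mDA : measurable (D `&` A : set (leb_rV R n)).
  by apply: null_meas; apply: negligibleS nA => y [].
have mDU j : measurable (D `\` U j : set (leb_rV R n)) by exact: measurableD.
have -> : D = (D `&` A) `|` \bigcup_j (D `\` U j).
  apply/seteqP; split=> [x Dx|x [[]//|[j _ []]//]].
  have [Ax|/existsNP[j /not_implyP[_ Ujx]]] := pselect (A x); first by left.
  by right; exists j.
apply/measurable_funU => //; first exact: bigcup_measurable.
split.
  move=> _ B mB; apply: null_meas; apply: negligibleS nA.
  by move=> y [[]].
apply/measurable_fun_bigcup => // j.
apply: (measurability _ (RGenOpens.measurableE R)).
move=> _ [_ [a [b ->] <-]].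
have [_ _ /continuousP cU] := HU j.
have : open ((f : subspace (D `\` U j) -> R) @^-1` `]a, b[%classic).
  by apply: cU; exact: interval_open.
move=> /open_subspaceP[V oV VU].
rewrite setIC -VU; apply: measurableI; last exact: mDU.
by apply: measurable_borel_leb; exact: open_measurable_rV.
Qed.

(** Layer-cake comparison: [g] is at most [2 eta] plus [eta] times the number of levels [eta * k.+1]
    below it; the measure of each level set is bounded by its capacity, and [eta] is chosen so that
    the term [2 eta] integrates to at most [e]. *)
Lemma integral_le_choquet : exists2 C : R, 0 < C &
  forall x r (A : set (leb_rV R n)) (g : leb_rV R n -> R), 0 < r ->
    measurable A -> measurable_fun A g -> (forall y, 0 <= g y) -> A `<=` cube x r ->
    (\int[lebesgue_rV n]_(y in A) (g y)%:E <=
     (C * r `^ (alpha * s))%:E * choquet alpha s A (EFin \o g))%E.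
Proof.
have [C C0 mucap] := lebesgue_rV_le_riesz_cap alpha0 alphan s1 alphas K0.
exists C => // x r A g r0 mA mg g0 Ax.
pose V := (r *+ 2) ^+ n; have V0 : 0 < V by rewrite exprn_gt0// mulrn_wgt0.
have muA : (lebesgue_rV n A <= V%:E)%E.
  rewrite -(lebesgue_rV_cube x (ltW r0)); apply: le_measure; rewrite ?inE//.
  exact: measurable_cube_leb.
apply/lee_addgt0Pr => e e0; rewrite addeC.
pose eta := e / V / 2; have eta0 : 0 < eta by rewrite !divr_gt0.
pose S k : set (leb_rV R n) := A `&` [set y | eta * k.+1%:R < g y].
have mS k : measurable (S k).
  have := mg mA `]eta * k.+1%:R, +oo[%classic (measurable_itv _).
  by congr measurable; apply/seteqP; split=> y [Ay]; rewrite /= in_itv/= andbT.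
have mI k : measurable_fun A (fun y : leb_rV R n => (\1_(S k) y)%:E : \bar R).
  by apply/measurable_EFinP; apply: measurable_indic; exact: mS.
have mF k : measurable_fun A (fun y : leb_rV R n => eta%:E * (\1_(S k) y)%:E)%E.
  by apply: measurable_funeM; exact: mI.
have F0 k (y : leb_rV R n) : (0 <= eta%:E * (\1_(S k) y)%:E)%E.
  by rewrite mule_ge0 ?lee_fin ?(ltW eta0).
have intF k : (\int[lebesgue_rV n]_(y in A) (eta%:E * (\1_(S k) y)%:E) =
    lebesgue_rV n (S k) * eta%:E)%E.
  rewrite ge0_integralZl_EFin; [|exact: mA|by move=> y _; rewrite lee_fin|exact: mI|exact: ltW].
  rewrite integral_indic; [|exact: mA|exact: mS].
  by rewrite muleC; congr (lebesgue_rV n _ * _)%E; apply/setIidPl => y [].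
apply: (@le_trans _ _ (\int[lebesgue_rV n]_(y in A)
   ((2 * eta)%:E + \sum_(k <oo) eta%:E * (\1_(S k) y)%:E))%E).
  apply: ge0_le_integral_nomeas => y Ay; first by rewrite lee_fin.
  pose m := Num.truncn (g y / eta).
  have /andP[m1 m2] : m%:R <= g y / eta < m.+1%:R.
    by apply: truncn_itv; rewrite divr_ge0// ltW.
  (* Level [eta * m] may equal [g y] and is not counted, since [S k] is defined by a strict
     inequality; so [m - 1] levels plus [2 eta] are used to exceed [g y < (m + 1) eta]. *)
  apply: (@le_trans _ _ ((2 * eta)%:E + \sum_(0 <= k < m.-1) eta%:E * (\1_(S k) y)%:E)%E).
    rewrite (eq_big_nat _ _ (F2 := fun=> eta%:E)) => [|k /andP[_ km]]; last first.
      rewrite indicE mem_set ?mule1//; split=> //=.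
      rewrite mulrC -ltr_pdivlMr//; apply: lt_le_trans m1.
      by rewrite ltr_nat; move: km; case: (m).
    rewrite sumEFin big_const_nat subn0 iter_addr addr0 -EFinD lee_fin.
    move: m2; rewrite ltr_pdivrMr// => /ltW/le_trans; apply.
    rewrite -[eta *+ _]mulr_natl -mulrDl ler_pM2r//.
    by case: (m) => [|k]/=; rewrite -?natrD ?addr0 ler_nat.
  apply: leeD2l; apply: nneseries_lim_ge => k _ _; exact: F0.
rewrite ge0_integralD; last 5 first.
- exact: mA.
- by move=> y _; rewrite lee_fin mulr_ge0// ltW.
- exact: measurable_cst.
- by move=> y _; apply: nneseries_ge0 => k _ _; exact: F0.
- by apply: ge0_emeasurable_sum => [k y _ _|k _]; [exact: F0|exact: mF].
apply: leeD.
  rewrite integral_cst; last exact: mA.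
  apply: (@le_trans _ _ ((2 * eta)%:E * V%:E)%E).
    by apply: lee_wpmul2l; [rewrite lee_fin mulr_ge0// ltW|exact: muA].
  by rewrite -EFinM lee_fin /eta le_eqVlt; apply/orP; left; apply/eqP; field; rewrite gt_eqF.
rewrite integral_nneseries; last 3 first.
- exact: mA.
- exact: mF.
- by move=> k y _; exact: F0.
pose c := C * r `^ (alpha * s); have c0 : 0 <= c by rewrite mulr_ge0 ?powR_ge0 ?(ltW C0).
apply: (@le_trans _ _ (c%:E * \sum_(k <oo) riesz_cap alpha s (S k) * eta%:E)%E).
  rewrite -nneseriesZl => [|k _]; last by rewrite mule_ge0 ?riesz_cap_ge0 ?lee_fin ?(ltW eta0).
  apply: lee_nneseries => k _; first by move=> _; apply: integral_ge0 => y _; exact: F0.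
  rewrite intF muleA; apply: lee_wpmul2r; first by rewrite lee_fin ltW.
  by apply: (mucap x) => // y [/Ax].
apply: lee_wpmul2l; first by rewrite lee_fin.
exact: le_choquet_superlevels.
Qed.

End lebesgue_points.

Lemma near_at_right0 (R : realType) (P : R -> Prop) (rho : R) : 0 < rho ->
  (forall r, 0 < r -> r < rho -> P r) -> \forall r \near 0^'+, P r.
Proof.
move=> rho0 h; near=> r; apply: h; near: r.
  exact: nbhs_right_gt.
exact: nbhs_right_lt.
Unshelve. all: by end_near.
Qed.

(** * Averages over balls *)

Section averages_of_f.
Context {R : realType} {n : nat}.
Variables alpha s p : R.
Hypotheses (alpha0 : 0 < alpha) (alphan : alpha < n%:R) (s1 : 1 < s).
Hypotheses (alphas : alpha * s < n%:R) (p1 : 1 <= p).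
Hypothesis K0 : 0 < (@riesz_const R n alpha)^-1.
Variables (D : set (leb_rV R n)) (f : leb_rV R n -> R).
Hypotheses (mD : measurable D) (mf : measurable_fun D f).
Hypothesis nD : (lebesgue_rV n).-negligible (~` D).
Implicit Types x y : 'rV[R]_n.
Let d := n%:R - alpha * s.
Let p0 : 0 < p. Proof. exact: lt_le_trans p1. Qed.
Let B x r : set (leb_rV R n) := eucl_ball x r `&` D.

Let mB x r : measurable (B x r).
Proof. by apply: measurableI; [exact: measurable_eucl_ball|exact: mD]. Qed.

Let mfB x r : measurable_fun (B x r) f.
Proof. by apply: measurable_funS mf; [exact: mD|move=> y []]. Qed.

Let muB x r : lebesgue_rV n (eucl_ball x r) = lebesgue_rV n (B x r).
Proof.
have mE := @measurable_eucl_ball R n x r.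
apply/eqP; rewrite eq_le; apply/andP; split; last first.
  by apply: le_measure; rewrite ?inE; [exact: mB|exact: mE|move=> y []].
have -> : eucl_ball x r = B x r `|` (eucl_ball x r `\` D).
  by apply/seteqP; split=> [y yr|y [[]|[]]//]; have [Dy|Dy] := pselect (D y); [left|right].
apply: le_trans (measureU2 _ _ _) _; [exact: mB|exact: measurableD|].
rewrite [X in (_ + X)%E](_ : _ = 0%E) ?adde0//.
apply: measure_negligible; first exact: measurableD.
by apply: negligibleS nD => y [].
Qed.

(** An inscribed and a circumscribed cube bracket the volume up to dimensional constants. *)
Lemma lebesgue_rV_eucl_ball_fin x r : 0 < r -> exists2 v : R,
  lebesgue_rV n (eucl_ball x r) = v%:E & (2 / n.+1%:R) ^+ n * r ^+ n <= v <= 2 ^+ n * r ^+ n.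
Proof.
move=> r0; have rn0 : 0 <= r / n.+1%:R by rewrite divr_ge0 ?(ltW r0).
have lo : (((2 / n.+1%:R) ^+ n * r ^+ n)%:E <= lebesgue_rV n (eucl_ball x r))%E.
  apply: (@le_trans _ _ (lebesgue_rV n (cube x (r / n.+1%:R)))).
    rewrite lebesgue_rV_cube// lee_fin -exprMn le_eqVlt; apply/orP; left; apply/eqP.
    by congr (_ ^+ n); rewrite -[RHS]mulr_natl mulrAC mulrA.
  apply: le_measure; rewrite ?inE; [exact: measurable_cube_leb|exact: measurable_eucl_ball|].
  exact: sub_cube_eucl_ball.
have hi : (lebesgue_rV n (eucl_ball x r) <= (2 ^+ n * r ^+ n)%:E)%E.
  apply: (@le_trans _ _ (lebesgue_rV n (cube x r))).
    apply: le_measure; rewrite ?inE; [exact: measurable_eucl_ball|exact: measurable_cube_leb|].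
    exact: sub_eucl_ball_cube.
  by rewrite lebesgue_rV_cube ?(ltW r0)// -exprMn mulr_natl.
move: lo hi; case: (lebesgue_rV n _) => [v| |]//; rewrite !lee_fin => lo hi.
by exists v => //; rewrite lo.
Qed.

Let integrable_cst_ball x r (k : R) : 0 < r ->
  (lebesgue_rV n).-integrable (B x r) (EFin \o cst k).
Proof.
move=> r0; have [v vE _] := lebesgue_rV_eucl_ball_fin x r0.
apply/integrableP; split; first exact/measurable_EFinP/measurable_cst.
have -> : (\int[lebesgue_rV n]_(y in B x r) `|(EFin \o cst k) y| =
    `|k|%:E * lebesgue_rV n (B x r))%E.
  by rewrite -integral_cst; [|exact: mB].
by rewrite -muB vE ltry.
Qed.

(** The weighted inequality with parameter [e] passes from exponent [p] to 1, and the comparison of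
    integrals with Choquet integrals contributes [r^(alpha s)], which completes [r^d] to [r^n]. *)
Lemma mean_oscillation_small : exists2 C : R, 0 < C & forall x,
  small_oscillation alpha s p D f x -> forall e, 0 < e ->
  exists2 rho : R, 0 < rho & forall r, 0 < r -> r < rho ->
    (\int[lebesgue_rV n]_(y in B x r) `|f y - f x|%:E <= (C * e * r ^+ n)%:E)%E.
Proof.
have [C1 C10 hC] := integral_le_choquet alpha0 alphan s1 alphas K0.
exists (2 ^+ n + C1); first by rewrite addr_gt0 ?exprn_gt0.
(* Smallness is requested at [e^p], so that the weight [e^(1-p)] turns it back into [e]. *)
move=> x [Dx osc] e e0; have [rho rho0 hrho] := osc _ (powR_gt0 p e0).
exists rho => // r r0 rrho; have {hrho} := hrho r r0 rrho => small.
have mg : measurable_fun (B x r) (fun y : leb_rV R n => `|f y - f x|).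
  apply: measurableT_comp; first exact: normr_measurable.
  by apply: measurable_funB; [exact: mfB|exact: measurable_cst].
have mgp : measurable_fun (B x r) (fun y : leb_rV R n => `|f y - f x| `^ p).
  exact: (measurableT_comp (measurable_powR _) mg).
have e1 : 0 <= e `^ (1 - p) by exact: powR_ge0.
apply: (@le_trans _ _ (\int[lebesgue_rV n]_(y in B x r)
    (e%:E + (e `^ (1 - p))%:E * (`|f y - f x| `^ p)%:E))%E).
  apply: ge0_le_integral_nomeas => y _; first by rewrite lee_fin.
  by rewrite -EFinM -EFinD lee_fin le_weighted_powR.
rewrite ge0_integralD; last 5 first.
- exact: mB.
- by move=> y _; rewrite lee_fin ltW.
- exact: measurable_cst.
- by move=> y _; rewrite -EFinM lee_fin mulr_ge0 ?powR_ge0.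
- by apply: measurable_funeM; exact/measurable_EFinP.
rewrite mulrDl mulrDl EFinD; apply: leeD.
  rewrite integral_cst; last exact: mB.
  have [v vE /andP[_ hv]] := lebesgue_rV_eucl_ball_fin x r0.
  by rewrite -muB vE -EFinM lee_fin (mulrC _ e) -mulrA ler_wpM2l// ltW.
rewrite ge0_integralZl_EFin; last 4 first.
- exact: mB.
- by move=> y _; rewrite lee_fin powR_ge0.
- exact/measurable_EFinP.
- exact: e1.
have h := hC x r (B x r) (fun y => `|f y - f x| `^ p) r0 (mB x r) mgp (fun y => powR_ge0 _ _).
apply: (@le_trans _ _ ((e `^ (1 - p))%:E * ((C1 * r `^ (alpha * s))%:E *
    (e `^ p * r `^ d)%:E))%E).
  apply: lee_wpmul2l; first by rewrite lee_fin.
  apply: le_trans (h _) _; first by move=> y [/(@sub_eucl_ball_cube _ _ _ _)].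
  by apply: lee_wpmul2l; rewrite ?lee_fin ?mulr_ge0 ?powR_ge0 ?(ltW C10).
rewrite -!EFinM lee_fin le_eqVlt; apply/orP; left; apply/eqP.
have ee : e `^ (1 - p) * e `^ p = e.
  by rewrite -powRD ?subrK ?powRr1 ?(ltW e0)// (gt_eqF e0) implybT.
have rr : r `^ (alpha * s) * r `^ d = r ^+ n.
  rewrite -powRD; last by rewrite (gt_eqF r0) implybT.
  by rewrite /d addrC subrK powR_mulrn// ltW.
transitivity (C1 * (e `^ (1 - p) * e `^ p) * (r `^ (alpha * s) * r `^ d)); first by ring.
by rewrite ee rr.
Qed.

Lemma small_oscillation_integrable x : small_oscillation alpha s p D f x ->
  exists2 rho : R, 0 < rho & forall r, 0 < r -> r < rho ->
    (lebesgue_rV n).-integrable (B x r) (EFin \o f).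
Proof.
move=> osc; have [C C0 h] := mean_oscillation_small.
have [rho rho0 hrho] := h x osc 1 ltr01; exists rho => // r r0 rrho.
have icst := @integrable_cst_ball x r (f x) r0.
have idiff : (lebesgue_rV n).-integrable (B x r) (fun y => (f y - f x)%:E).
  apply/integrableP; split.
    apply/measurable_EFinP; apply: measurable_funB; [exact: mfB|exact: measurable_cst].
  apply: le_lt_trans (ltry (C * 1 * r ^+ n)); exact: hrho.
have := integrableD (mB x r) idiff icst; apply: eq_integrable; first exact: mB.
by move=> y _ /=; rewrite -EFinD subrK.
Qed.

Lemma small_oscillation_average x : small_oscillation alpha s p D f x ->
  ball_average D f x r @[r --> 0^'+] --> f x.
Proof.
move=> osc; have [C C0 h] := mean_oscillation_small.
have [rho1 rho10 hint] := small_oscillation_integrable osc.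
pose c : R := (2 / n.+1%:R) ^+ n.
have c0 : 0 < c by rewrite exprn_gt0 ?divr_gt0.
apply/cvgrPdist_le => e e0.
(* With this choice the oscillation bound [C * e' * r^n] becomes [e * (c * r^n)], at most [e] times
   the volume of the ball. *)
have e'0 : 0 < e * c / C by rewrite divr_gt0 ?mulr_gt0.
have [rho2 rho20 hrho] := h x osc _ e'0.
apply: (@near_at_right0 _ _ (Num.min rho1 rho2)); first by rewrite lt_min rho10.
move=> r r0; rewrite lt_min => /andP[r1 r2].
have [v vE /andP[lo hi]] := lebesgue_rV_eucl_ball_fin x r0.
have v0 : 0 < v by apply: lt_le_trans lo; rewrite mulr_gt0 ?exprn_gt0.
have iF := hint r r0 r1.
have icst := @integrable_cst_ball x r (f x) r0.
have idiff : (lebesgue_rV n).-integrable (B x r) (EFin \o (fun y => f y - f x)).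
  have := integrableB (mB x r) iF icst; apply: eq_integrable; first exact: mB.
  by move=> y _ /=; rewrite -EFinB.
have -> : f x - ball_average D f x r =
    - (v^-1 * \int[lebesgue_rV n]_(y in B x r) (f y - f x)).
  rewrite RintegralB; [|exact: mB|exact: iF|exact: icst].
  rewrite Rintegral_cst; last exact: mB.
  rewrite -muB /ball_average vE /=; field; exact: lt0r_neq0.
rewrite normrN normrM ger0_norm ?invr_ge0 ?(ltW v0)//.
rewrite mulrC ler_pdivrMr//.
apply: (@le_trans _ _ (C * (e * c / C) * r ^+ n)); last first.
  have -> : C * (e * c / C) * r ^+ n = e * (c * r ^+ n) by field; exact: lt0r_neq0.
  by rewrite ler_pM2l.
apply: le_trans (le_normr_Rintegral _ _) _; [exact: mB|exact: idiff|].
have hr := hrho r r0 r2.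
rewrite -lee_fin /Rintegral fineK//.
rewrite ge0_fin_numE; last by apply: integral_ge0 => y _; rewrite lee_fin.
by apply: le_lt_trans hr _; rewrite ltry.
Qed.

End averages_of_f.

Lemma small_oscillation_choquet_cvg0 (R : realType) (n : nat) (alpha s p c : R)
    (D : set 'rV[R]_n) (f : 'rV[R]_n -> R) x : 1 < s -> 0 < c ->
  small_oscillation alpha s p D f x ->
  ((c%:E * (r `^ (n%:R - alpha * s))%:E)^-1 *
     choquet alpha s (eucl_ball x r `&` D) (fun y => (`|f y - f x| `^ p)%:E))%E
  @[r --> 0^'+] --> 0%E.
Proof.
move=> s1 c0 [Dx osc].
have bound (e : R) : 0 < e -> \forall r \near 0^'+,
  (0 <= (c%:E * (r `^ (n%:R - alpha * s))%:E)^-1 *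
     choquet alpha s (eucl_ball x r `&` D) (fun y => (`|f y - f x| `^ p)%:E) <= e%:E)%E.
  move=> e0; have [|rho rho0 hrho] := osc (c * e); first by rewrite mulr_gt0.
  apply: (near_at_right0 rho0) => r r0 rrho.
  have cr0 : 0 < c * r `^ (n%:R - alpha * s) by rewrite mulr_gt0 ?powR_gt0.
  rewrite -EFinM inver gt_eqF//; apply/andP; split.
    by apply: mule_ge0; [rewrite lee_fin invr_ge0 ltW|exact: choquet_ge0].
  apply: (@le_trans _ _ (((c * r `^ (n%:R - alpha * s))^-1)%:E *
      (c * e * r `^ (n%:R - alpha * s))%:E)%E).
    by apply: lee_wpmul2l; [rewrite lee_fin invr_ge0 ltW|exact: hrho].
  rewrite -EFinM lee_fin le_eqVlt; apply/orP; left; apply/eqP.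
  by field; rewrite !gt_eqF ?powR_gt0.
apply/fine_cvgP; split.
  apply: filterS (bound 1 ltr01) => r /andP[h0 h1].
  by rewrite ge0_fin_numE// (le_lt_trans h1) ?ltry.
apply/cvgrPdist_le => e e0; apply: filterS (bound e e0) => r /andP[h0 h1] /=.
rewrite sub0r normrN ger0_norm ?fine_ge0// -lee_fin fineK//.
by rewrite ge0_fin_numE// (le_lt_trans h1) ?ltry.
Qed.

(* [Gamma] could a priori take the junk value 0; then the kernel vanishes and
   nonempty sets have infinite capacity. *)
Lemma riesz_cap_const0 (R : realType) (n : nat) (alpha s : R) (E : set 'rV[R]_n) x :
  1 < s -> (@riesz_const R n alpha)^-1 = 0 -> E x -> riesz_cap alpha s E = +oo%E.
Proof.
move=> s1 K0 Ex; rewrite riesz_capE//; apply/ereal_inf_pinfty => _ [phi [_ _ h] <-].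
have := h x Ex; rewrite /riesz_potential integral0_eq ?lee_fin ?ler10// => y _.
by rewrite /riesz_kernel K0 !mul0e.
Qed.

Theorem corollary1p7 (R : realType) (n : nat) (alpha s p : R)
    (D : set 'rV[R]_n) (f : 'rV[R]_n -> R) :
  0 < alpha -> alpha < n%:R ->
  1 < s -> s < n%:R / alpha ->
  1 <= p ->
  Lp_cap alpha s p D f ->
  cap_ae alpha s (fun x : 'rV[R]_n =>
    [/\ \forall r \near 0^'+,
          (lebesgue_rV n).-integrable (eucl_ball x r `&` D) (EFin \o f),
        cvg (ball_average D f x r @[r --> 0^'+]) &
        ((riesz_cap alpha s (eucl_ball (0 : 'rV[R]_n) 1) *
            (r `^ (n%:R - alpha * s))%:E)^-1 *
          choquet alpha s (eucl_ball x r `&` D)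
            (fun y => (`|f y - average_limit D f x| `^ p)%:E))%E
          @[r --> 0^'+] --> 0%E]).
Proof.
move=> alpha0 alphan s1; rewrite ltr_pdivlMr// mulrC => alphas p1 Lpf.
have p0 : 0 < p by exact: lt_le_trans p1.
have [K0|K0] := eqVneq (@riesz_const R n alpha)^-1 0.
  have capy (E : set 'rV[R]_n) x : E x -> riesz_cap alpha s E = +oo%E.
    exact: riesz_cap_const0.
  have f0 y : D y -> f y = 0.
    move=> Dy; apply: contrapT => /eqP fy.
    have fp : 0 < `|f y| `^ p by rewrite powR_gt0 ?normr_gt0.
    (* With mesh half of [|f y|^p] the first superlevel set contains [y]; its infinite capacity
       would make the Choquet integral infinite. *)
    have eta0 : 0 < `|f y| `^ p / 2 by rewrite divr_gt0.
    have := @le_choquet_superlevels R n alpha s s1 D (fun y => `|f y| `^ p) _ eta0.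
    rewrite leNgt => /negP; apply.
    have [_ /lty_poweRy] := Lpf; rewrite invr_eq0 gt_eqF// => /(_ isT)/lt_le_trans; apply.
    pose F k := (riesz_cap alpha s [set z | D z /\
      (`|f y| `^ p / 2 * k.+1%:R < `|f z| `^ p)%R] * (`|f y| `^ p / 2)%:E)%E.
    apply: le_trans (@le_nneseries_term _ F 0%N _) => [|k]; last first.
      by rewrite /F mule_ge0 ?riesz_cap_ge0// lee_fin ltW.
    rewrite /F (capy _ y) ?gt0_mulye ?lte_fin//.
    by split=> //; rewrite mulr1 ltr_pdivrMr// mulr_natr mulr2n ltrDl.
  have [[[N capN ND] _] _] := Lpf.
  (* Only the empty set has zero capacity in this degenerate case, so [D] is the whole space and [f]
     vanishes everywhere. *)
  have DT y : D y.
    by apply: ND => Ny; move: capN; rewrite (capy _ _ Ny).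
  have {f0} -> : f = cst 0 by apply/funext => y; exact: f0.
  exists set0 => [|x _]; first exact: riesz_cap0.
  have avg0 : ball_average D (cst 0) x r @[r --> 0^'+] --> (0 : R).
    rewrite (_ : (fun r => _) = cst 0); first exact: cvg_cst.
    by apply/funext => r; rewrite /ball_average /Rintegral integral0 mulr0.
  have lim0 : average_limit D (cst 0) x = 0 by exact: cvg_lim avg0.
  split.
  - by apply: nearW => r; exact: integrable0.
  - by apply/cvg_ex; exists 0.
  - rewrite lim0 (_ : (fun r => _) = cst 0%E); first exact: cvg_cst.
    apply/funext => r; rewrite [X in (_ * X)%E](_ : _ = 0%E) ?mule0//.
    apply: integral0_eq => t; rewrite /= in_itv/= andbT => t0.
    rewrite (_ : [set y | _] = set0) ?riesz_cap0//.
    apply/seteqP; split=> // y /= [_].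
    by rewrite subrr normr0 powR0 ?gt_eqF// lte_fin ltNge t0.
have {}K0 : 0 < (@riesz_const R n alpha)^-1.
  by rewrite lt_def K0 invr_ge0 riesz_const_ge0.
have [qc _] := Lpf; have [mD mf] := quasicontinuous_measurable alpha0 alphan s1 alphas K0 qc.
have nD : (lebesgue_rV n).-negligible (~` D : set (leb_rV R n)).
  have [[N capN ND] _] := qc.
  apply: negligibleS (riesz_cap_eq0_negligible alpha0 alphan s1 alphas K0 capN).
  by move=> y Dy; apply: contrapT => /ND.
have [N capN osc] := small_oscillation_ae alphan s1 alphas p1 K0 Lpf.
exists N => // x /osc ox.
have avg := small_oscillation_average alpha0 alphan s1 alphas p1 K0 mD mf nD ox.
have limE : average_limit D f x = f x by exact: cvg_lim avg.
split.
- have [rho rho0 h] := small_oscillation_integrable alpha0 alphan s1 alphas p1 K0 mD mf nD ox.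
  exact: (near_at_right0 rho0).
- by apply/cvg_ex; exists (f x).
rewrite limE.
have [C _ capC] := riesz_cap_cube_le alphan s1 K0.
have c0 := riesz_cap_ball_gt0 alpha0 alphan s1 alphas K0.
(* Finite and positive, the normalizing capacity is a real [c > 0], and its extended inverse is the
   ordinary one. *)
have : (riesz_cap alpha s (eucl_ball (0 : 'rV[R]_n) 1) < +oo)%E.
  apply: le_lt_trans (le_lt_trans (capC 0 1 ltr01) (ltry _)).
  by apply: le_riesz_cap => //; exact: sub_eucl_ball_cube.
move: c0; case: (riesz_cap alpha s (eucl_ball 0 1)) => [c| |]//; rewrite lte_fin => c0 _.
exact: small_oscillation_choquet_cvg0.
Qed.
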